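(* Let $\mathbb{K}$ be a field, $k \geq 2$ and $p \geq 2$. Assume that the Stanley conjecture holds for $S/I$ for all monomial ideals $I\subset S$ (in all polynomial rings $S$ over $\mathbb{K}$ in finitely many variables) with $L_I \cong \mathcal{L}(\Delta)$ for some $(p-1)$-dimensional stoss complex $\Delta$ with $k$ vertices. Then the Stanley conjecture holds for $S/I$ for all monomial ideals $I\subset S$ (in all polynomial rings $S$ over $\mathbb{K}$) with $k$ minimal generators and with $S/I$ of projective dimension $p$. The same statement holds for $I$ instead of $S/I$: if the Stanley conjecture holds for the module $I$ for all monomial ideals $I$ with $L_I \cong \mathcal{L}(\Delta)$ for some $(p-1)$-dimensional stoss complex $\Delta$ with $k$ vertices, then it holds for the module $I$ for all monomial ideals $I$ with $k$ minimal generators such that $\operatorname{pdim} S/I = p$.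
   Context: $\mathbb{K}$ is a fixed field and $S=\mathbb{K}[X_1,\dots,X_n]$ with its fine $\mathbb{Z}^n$-grading; $n$ is arbitrary. Monomial ideals are taken to be nonzero and proper. Stanley depth: for a finitely generated $\mathbb{Z}^n$-graded $S$-module $M$, a Stanley space of $M$ is a $\mathbb{K}[Z]$-submodule $\lambda\mathbb{K}[Z]\subseteq M$ with $\lambda\in M$ homogeneous, $Z\subseteq\{X_1,\dots,X_n\}$, which is free over $\mathbb{K}[Z]$. A Stanley decomposition of $M$ is a finite family of Stanley spaces $\lambda_i\mathbb{K}[Z_i]$ of $M$ with $M\cong\bigoplus_i\lambda_i\mathbb{K}[Z_i]$ as multigraded $\mathbb{K}$-vector spaces; its depth is $\min_i|Z_i|$. $\operatorname{sdepth} M$ is the maximal depth of a Stanley decomposition of $M$, and $\operatorname{spdim}M := n-\operatorname{sdepth}M$. ''The Stanley conjecture holds for $M$'' means $\operatorname{depth}M\le\operatorname{sdepth}M$, equivalently $\operatorname{spdim}M\le\operatorname{pdim}M$, where $\operatorname{pdim}$ is the projective dimension over $S$. Lcm lattice: $L_I$ is the lattice of all least common multiples of subsets of the minimal monomial generators of $I$ (the empty subset giving the minimal element), ordered by divisibility. Stoss complex: a $d$-dimensional simplicial complex $\Delta$ with vertex set $[k]=\{1,\dots,k\}$ is a stoss complex if it has a complete $(d-1)$-skeleton (every subset of $[k]$ with at most $d$ elements is a face) and is $\mathbb{K}$-acyclic (all reduced homology over $\mathbb{K}$ vanishes). For such $\Delta$, $\mathcal{L}(\Delta):=\{V\subseteq[k]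 : \Delta|_V \text{ is } \mathbb{K}\text{-acyclic}\}$, ordered by inclusion, where $\Delta|_V$ is the restriction of $\Delta$ to $V$ and by convention $V=\emptyset$ always belongs to $\mathcal{L}(\Delta)$. It is closed under intersection and contains $\emptyset$ and $[k]$, hence is a finite lattice. *)

(* Defs.v *)
From HB Require Import structures.
From mathcomp Require Import all_boot all_order all_algebra.
From mathcomp Require Import generic_quotient ring_quotient.
From mathcomp.multinomials Require Export mpoly.

Set Implicit Arguments.
Unset Strict Implicit.
Unset Printing Implicit Defensive.

Import GRing.Theory.
Local Open Scope ring_scope.

Definition projective (R : comNzRingType) (P : lmodType R) : Prop :=
  forall (A B : lmodType R) (g : {linear A -> B}) (f : {linear P -> B}),
    (forall b, exists a, g a = b) ->
    exists h : {linear P -> A}, forall x, g (h x) = f x.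

(* 0 -> P d -> ... -> P 1 -> P 0 -> M -> 0 is encoded by an infinite exact
   sequence with P i = 0 for i > d. *)
Definition pdim_le (R : comNzRingType) (M : lmodType R) (d : nat) : Prop :=
  exists (P : nat -> lmodType R) (delta : forall i, {linear P i.+1 -> P i})
         (eps : {linear P 0%N -> M}),
    [/\ forall i, projective (P i),
        forall i, (d < i)%N -> forall x : P i, x = 0,
        forall y, exists x, eps x = y,
        forall x, eps x = 0 <-> exists y, delta 0%N y = x &
        forall i x, delta i x = 0 <-> exists y, delta i.+1 y = x].

Definition is_pdim (R : comNzRingType) (M : lmodType R) (d : nat) : Prop :=
  pdim_le M d /\ forall e, pdim_le M e -> (d <= e)%N.

Definition mdegree (n : nat) := {ffun 'I_n -> int}.

Definition mdeg_of n (m : 'X_{1..n}) : mdegree n := [ffun i => (m i)%:Z].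

Record mgmod (K : fieldType) (n : nat) := MGMod {
  mg_sort :> lmodType {mpoly K[n]};
  mg_homog : mdegree n -> mg_sort -> Prop;
  mg_homog0 : forall a, mg_homog a 0;
  mg_homogD : forall a (c : K) x y,
    mg_homog a x -> mg_homog a y -> mg_homog a (c%:MP *: x + y);
  mg_homogX : forall a (m : 'X_{1..n}) x,
    mg_homog a x -> mg_homog (mdeg_of m + a) ('X_[m] *: x);
  mg_span : forall x, exists (s : seq (mdegree n)) (f : mdegree n -> mg_sort),
    [/\ uniq s, forall a, mg_homog a (f a) & x = \sum_(a <- s) f a];
  mg_indep : forall (s : seq (mdegree n)) (f : mdegree n -> mg_sort),
    uniq s -> (forall a, a \in s -> mg_homog a (f a)) ->
    \sum_(a <- s) f a = 0 -> forall a, a \in s -> f a = 0 }.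

Arguments mg_homog {K n} M a x : rename.

Section StanleyDepth.

Variables (K : fieldType) (n : nat).

Definition in_KZ (Z : {set 'I_n}) (q : {mpoly K[n]}) : Prop :=
  forall m, m \in msupp q -> forall i, m i != 0%N -> i \in Z.

Variable M : mgmod K n.

(* lambda K[Z], free over K[Z] with basis lambda. *)
Record stanley_space := StanleySpace {
  st_gen : M;
  st_vars : {set 'I_n};
  st_homog : exists a, mg_homog M a st_gen;
  st_free : forall q, in_KZ st_vars q -> q *: st_gen = 0 -> q = 0 }.

Definition in_space (W : stanley_space) (x : M) : Prop :=
  exists2 q, in_KZ (st_vars W) q & x = q *: st_gen W.

(* Phi is an isomorphism of multigraded K-vector spaces from the external
   direct sum of the W i, i.e. the families v with v i in W i, onto M. *)
Definition stanley_decomposition r (W : 'I_r -> stanley_space) : Prop :=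
  let V (v : {ffun 'I_r -> M}) := forall i, in_space (W i) (v i) in
  exists Phi : {ffun 'I_r -> M} -> M,
    [/\ forall (c : K) u v, V u -> V v ->
          Phi (c%:MP *: u + v) = c%:MP *: Phi u + Phi v,
        forall a v, V v -> (forall i, mg_homog M a (v i)) ->
          mg_homog M a (Phi v),
        forall u v, V u -> V v -> Phi u = Phi v -> u = v &
        forall x, exists2 v, V v & Phi v = x].

(* The default value n is reached only by the empty family, i.e. if M = 0;
   otherwise it has no effect, as #|Z_i| <= n. *)
Definition decomposition_depth r (W : 'I_r -> stanley_space) : nat :=
  \big[minn/n]_(i < r) #|st_vars (W i)|.

Definition is_sdepth (d : nat) : Prop :=
  (exists r (W : 'I_r -> stanley_space),
     stanley_decomposition W /\ decomposition_depth W = d) /\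
  (forall r (W : 'I_r -> stanley_space),
     stanley_decomposition W -> (decomposition_depth W <= d)%N).

(* Every decomposition depth is at most n, so this subtraction never truncates. *)
Definition is_spdim (e : nat) : Prop := exists2 d, is_sdepth d & e = (n - d)%N.

(* spdim M <= pdim M; by the Auslander-Buchsbaum formula this is
   depth M <= sdepth M. *)
Definition stanley_conjecture : Prop :=
  exists e p, [/\ is_spdim e, is_pdim M p & (e <= p)%N].

End StanleyDepth.

(* idealr is the library's type of proper ideals. *)
Record monomial_ideal (K : fieldType) (n : nat) := MonomialIdeal {
  mi_ideal :> idealr {mpoly K[n]};
  mi_neq0 : exists2 p, p \in mi_ideal & p != 0;
  mi_gen : exists G : 'X_{1..n} -> Prop, forall p, p \in mi_ideal <->
    exists s : seq ({mpoly K[n]} * 'X_{1..n}),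
      (forall t, t \in s -> G t.2) /\ p = \sum_(t <- s) t.1 * 'X_[t.2] }.

Section IdealModules.

Variables (R : comNzRingType) (I : idealr R).

Definition quot_scale (r : R) (x : {ideal_quot I}) : {ideal_quot I} :=
  \pi_{ideal_quot I}%qT r * x.

Fact quot_scaleA a b x : quot_scale a (quot_scale b x) = quot_scale (a * b) x.
Proof. by rewrite /quot_scale rmorphM mulrA. Qed.

Fact quot_scale1 : left_id 1 quot_scale.
Proof. by move=> x; rewrite /quot_scale rmorph1 mul1r. Qed.

Fact quot_scaleDr : right_distributive quot_scale +%R.
Proof. by move=> a x y; rewrite /quot_scale mulrDr. Qed.

Fact quot_scaleDl v : {morph quot_scale^~ v : a b / a + b}.
Proof. by move=> a b; rewrite /quot_scale rmorphD mulrDl. Qed.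

HB.instance Definition _ := GRing.Zmodule_isLmodule.Build R {ideal_quot I}
  quot_scaleA quot_scale1 quot_scaleDr quot_scaleDl.

Record ideal_module := IdealModule {
  ideal_val : R;
  ideal_valP : ideal_val \in (I : {pred R}) }.

HB.instance Definition _ := [isSub for ideal_val].
HB.instance Definition _ := [Choice of ideal_module by <:].
HB.instance Definition _ := [SubChoice_isSubZmodule of ideal_module by <:].

Definition ideal_scale (r : R) (x : ideal_module) : ideal_module :=
  IdealModule (idealMr r (ideal_valP x)).

Fact ideal_scaleA a b x :
  ideal_scale a (ideal_scale b x) = ideal_scale (a * b) x.
Proof. by apply: val_inj; rewrite /= mulrA. Qed.

Fact ideal_scale1 : left_id 1 ideal_scale.
Proof. by move=> x; apply: val_inj; rewrite /= mul1r. Qed.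

Fact ideal_scaleDr : right_distributive ideal_scale +%R.
Proof. by move=> a x y; apply: val_inj; apply: mulrDr. Qed.

Fact ideal_scaleDl v : {morph ideal_scale^~ v : a b / a + b}.
Proof. by move=> a b; apply: val_inj; apply: mulrDl. Qed.

HB.instance Definition _ := GRing.Zmodule_isLmodule.Build R ideal_module
  ideal_scaleA ideal_scale1 ideal_scaleDr ideal_scaleDl.

End IdealModules.

Section MultigradedIdealModules.

Variables (K : fieldType) (n : nat).
Implicit Types (p q : {mpoly K[n]}) (a b : mdegree n) (m : 'X_{1..n}).

Definition poly_homog a p : Prop := forall m, m \in msupp p -> mdeg_of m = a.

Fact mdeg_of_inj : injective (@mdeg_of n).
Proof.
move=> m m' /ffunP e; apply/mnmP => i.
by have := e i; rewrite !ffunE => -[].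
Qed.

Fact mdeg_ofD m m' : mdeg_of (m + m') = mdeg_of m + mdeg_of m'.
Proof. by apply/ffunP => i; rewrite !ffunE mnmDE PoszD. Qed.

Fact poly_homog0 a : poly_homog a 0.
Proof. by move=> m; rewrite msupp0. Qed.

Fact poly_homogD a (c : K) p q :
  poly_homog a p -> poly_homog a q -> poly_homog a (c%:MP * p + q).
Proof.
move=> hp hq m /msuppD_le; rewrite mem_cat mul_mpolyC.
by case/orP => [/msuppZ_le/hp|/hq].
Qed.

Fact poly_homogX a m p :
  poly_homog a p -> poly_homog (mdeg_of m + a) ('X_[m] * p).
Proof.
move=> hp m'; rewrite mulrC (perm_mem (msuppMX p m)) => /mapP[m1 hm1 ->].
by rewrite mdeg_ofD (hp _ hm1).
Qed.

Definition poly_part a p : {mpoly K[n]} :=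
  \sum_(m <- msupp p | mdeg_of m == a) p@_m *: 'X_[m].

Fact poly_partE a p m :
  (poly_part a p)@_m = if mdeg_of m == a then p@_m else 0.
Proof.
rewrite /poly_part raddf_sum /=.
transitivity (\sum_(m' <- msupp p | mdeg_of m' == a) p@_m' * (m' == m)%:R).
  by apply: eq_bigr => m' _; rewrite mcoeffZ mcoeffX.
case: ifP => hm; last first.
  apply: big1 => m' /eqP h; case: eqP => [e|]; last by rewrite mulr0.
  by rewrite -e h eqxx in hm.
case: (boolP (m \in msupp p)) => hs; last first.
  rewrite (memN_msupp_eq0 hs) big1_seq // => m' /andP[_ hm'].
  case: eqP => [e|]; last by rewrite mulr0.
  by rewrite e (negbTE hs) in hm'.
rewrite big_mkcond (bigD1_seq m) ?msupp_uniq //= hm eqxx mulr1.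
rewrite big1 ?addr0 // => m' /negbTE ->.
by rewrite mulr0 if_same.
Qed.

Fact poly_part_homog a p : poly_homog a (poly_part a p).
Proof.
by move=> m; rewrite mcoeff_msupp poly_partE; case: (_ =P a) => // _; rewrite eqxx.
Qed.

Fact poly_part_sum p :
  p = \sum_(a <- undup (map (@mdeg_of n) (msupp p))) poly_part a p.
Proof.
apply/mpolyP => m; rewrite raddf_sum /=.
under eq_bigr => a _ do rewrite poly_partE.
case: (boolP (m \in msupp p)) => hs; last first.
  by rewrite (memN_msupp_eq0 hs) big1 // => a _; rewrite if_same.
rewrite (bigD1_seq (mdeg_of m)) ?undup_uniq ?mem_undup ?map_f //= eqxx.
by rewrite big1 ?addr0 // => a /negbTE; rewrite eq_sym => ->.
Qed.

Fact poly_indep (s : seq (mdegree n)) (f : mdegree n -> {mpoly K[n]}) a m :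
  uniq s -> (forall b, b \in s -> poly_homog b (f b)) -> a \in s ->
  m \in msupp (f a) -> m \in msupp (\sum_(b <- s) f b).
Proof.
move=> us hf ha hm; rewrite mcoeff_msupp raddf_sum /= (bigD1_seq a) //=.
rewrite big1_seq ?addr0 -?mcoeff_msupp // => b /andP[hb bs].
apply: memN_msupp_eq0; apply/negP => /(hf _ bs) e.
by rewrite (hf _ ha _ hm) in e; rewrite e eqxx in hb.
Qed.

Variable I : monomial_ideal K n.

Fact msupp_ideal p m :
  p \in mi_ideal I -> m \in msupp p -> 'X_[m] \in mi_ideal I.
Proof.
have [G hG] := mi_gen I; case/hG => s [hs ->] hm; move: (msupp_sum_le hm) => {hm}.
case/flattenP => l /mapP[t]; rewrite mem_filter /= => ht ->.
rewrite (perm_mem (msuppMX _ _)) => /mapP[m' _ ->].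
rewrite mpolyXD mulrC; apply: idealMr; apply/hG.
exists [:: (1, t.2)]; split=> [u|]; last by rewrite big_seq1 mul1r.
by rewrite inE => /eqP -> /=; apply: hs.
Qed.

Fact ideal_msupp p :
  (forall m, m \in msupp p -> 'X_[m] \in mi_ideal I) -> p \in mi_ideal I.
Proof.
move=> h; rewrite [p]mpolyE big_seq; apply: rpred_sum => m hm.
by rewrite -mul_mpolyC; apply: idealMr; apply: h.
Qed.

Fact poly_part_ideal a p : p \in mi_ideal I -> poly_part a p \in mi_ideal I.
Proof.
move=> hp; apply: ideal_msupp => m hm; apply: (msupp_ideal hp).
by move: hm; rewrite !mcoeff_msupp poly_partE; case: ifP => //; rewrite eqxx.
Qed.

Local Notation Q := {ideal_quot (mi_ideal I)}.
Local Notation pi := (\pi_Q)%qT.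

Fact pi_eq0 p : pi p = 0 <-> p \in mi_ideal I.
Proof.
rewrite -[X in X \in _]subr0 Quotient.idealrBE.
by have e0 : pi 0 = 0 := rmorph0 pi; split=> [e|/eqP e]; [apply/eqP|]; rewrite e e0.
Qed.

Definition quot_homog a (x : Q) : Prop := exists2 p, poly_homog a p & pi p = x.

Fact quot_homog0 a : quot_homog a 0.
Proof. by exists 0; [apply: poly_homog0 | rewrite raddf0]. Qed.

Fact quot_homogD a (c : K) x y :
  quot_homog a x -> quot_homog a y -> quot_homog a (c%:MP *: x + y).
Proof.
move=> [p hp <-] [q hq <-]; exists (c%:MP * p + q); first exact: poly_homogD.
by rewrite rmorphD rmorphM.
Qed.

Fact quot_homogX a m x :
  quot_homog a x -> quot_homog (mdeg_of m + a) ('X_[m] *: x).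
Proof.
move=> [p hp <-]; exists ('X_[m] * p); first exact: poly_homogX.
by rewrite rmorphM.
Qed.

Fact quot_span (x : Q) : exists (s : seq (mdegree n)) (f : mdegree n -> Q),
  [/\ uniq s, forall a, quot_homog a (f a) & x = \sum_(a <- s) f a].
Proof.
exists (undup (map (@mdeg_of n) (msupp (repr x)))).
exists (fun a => pi (poly_part a (repr x))); split; first exact: undup_uniq.
  by move=> a; exists (poly_part a (repr x)); first exact: poly_part_homog.
by rewrite -raddf_sum -poly_part_sum; apply/esym/reprK.
Qed.

Fact quot_indep (s : seq (mdegree n)) (f : mdegree n -> Q) :
  uniq s -> (forall a, a \in s -> quot_homog a (f a)) ->
  \sum_(a <- s) f a = 0 -> forall a, a \in s -> f a = 0.
Proof.
move=> us hf.
have [g hg]: exists g : mdegree n -> {mpoly K[n]},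
    forall a, a \in s -> poly_homog a (g a) /\ pi (g a) = f a.
  elim: s {us} hf => [|b s IH] hf; first by exists (fun=> 0).
  have [a ha|g hg] := IH; first by apply: hf; rewrite inE ha orbT.
  have [p hp ep] := hf b (mem_head b s).
  exists (fun a => if a == b then p else g a) => a; rewrite inE.
  by case: eqP => [->|_] //= /hg.
have -> : \sum_(a <- s) f a = pi (\sum_(a <- s) g a).
  by rewrite raddf_sum big_seq [RHS]big_seq; apply: eq_bigr => a /hg[_ /esym].
move=> /pi_eq0 hI a ha; have [hga <-] := hg a ha.
apply/pi_eq0/ideal_msupp => m hm.
apply: (msupp_ideal hI); apply: (poly_indep us _ ha hm) => b hb.
by have [] := hg b hb.
Qed.

Definition quotient_mgmod : mgmod K n :=
  MGMod quot_homog0 quot_homogD quot_homogX quot_span quot_indep.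

Local Notation J := (ideal_module (mi_ideal I)).

Definition ideal_homog a (x : J) : Prop := poly_homog a (ideal_val x).

Fact ideal_homog0 a : ideal_homog a 0.
Proof. exact: poly_homog0. Qed.

Fact ideal_homogD a (c : K) x y :
  ideal_homog a x -> ideal_homog a y -> ideal_homog a (c%:MP *: x + y).
Proof. exact: poly_homogD. Qed.

Fact ideal_homogX a m x :
  ideal_homog a x -> ideal_homog (mdeg_of m + a) ('X_[m] *: x).
Proof. exact: poly_homogX. Qed.

Fact ideal_span (x : J) : exists (s : seq (mdegree n)) (f : mdegree n -> J),
  [/\ uniq s, forall a, ideal_homog a (f a) & x = \sum_(a <- s) f a].
Proof.
exists (undup (map (@mdeg_of n) (msupp (ideal_val x)))).
exists (fun a => IdealModule (poly_part_ideal a (ideal_valP x))).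
split; [exact: undup_uniq | by move=> a; apply: poly_part_homog |].
by apply: val_inj; rewrite raddf_sum /= -poly_part_sum.
Qed.

Fact ideal_indep (s : seq (mdegree n)) (f : mdegree n -> J) :
  uniq s -> (forall a, a \in s -> ideal_homog a (f a)) ->
  \sum_(a <- s) f a = 0 -> forall a, a \in s -> f a = 0.
Proof.
move=> us hf /(congr1 val); rewrite raddf_sum /= => e a ha.
apply: val_inj; apply/mpolyP => m; rewrite mcoeff0.
apply/eqP; rewrite mcoeff_eq0; apply/negP => hm.
by have := poly_indep us hf ha hm; rewrite e msupp0.
Qed.

Definition ideal_mgmod : mgmod K n :=
  MGMod ideal_homog0 ideal_homogD ideal_homogX ideal_span ideal_indep.

Definition minimal_generator m : Prop :=
  'X_[m] \in mi_ideal I /\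
  forall m', 'X_[m'] \in mi_ideal I -> (m' <= m)%MM -> m' = m.

Definition has_mingens (k : nat) : Prop :=
  exists s : seq 'X_{1..n},
    [/\ uniq s, size s = k & forall m, m \in s <-> minimal_generator m].

Definition in_lcm_lattice m : Prop :=
  exists2 s : seq 'X_{1..n}, (forall g, g \in s -> minimal_generator g) &
    m = foldr (@mlcm n) 0%MM s.

End MultigradedIdealModules.

Section StossComplexes.

Variables (K : fieldType) (k : nat).
Implicit Types (D : {set {set 'I_k}}) (F G V : {set 'I_k}).

Definition is_complex D : Prop :=
  forall F G, F \in D -> G \subset F -> G \in D.

Definition restriction D V : {set {set 'I_k}} := [set F in D | F \subset V].

(* Chains are coefficient families indexed by all subsets of the vertex set;
   those of D in dimension j.-1 are supported on the faces with j elements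
   (so j = 0 gives the empty face). *)
Definition is_chain D (j : nat) (c : {ffun {set 'I_k} -> K}) : Prop :=
  forall F, c F != 0 -> F \in D /\ #|F| = j.

Definition boundary (c : {ffun {set 'I_k} -> K}) : {ffun {set 'I_k} -> K} :=
  [ffun G : {set 'I_k} => \sum_(F : {set 'I_k}) \sum_(v in F | F :\ v == G)
     (-1) ^+ #|[set u in F | (u < v)%N]| * c F].

Definition acyclic D : Prop :=
  forall j c, is_chain D j c -> boundary c = 0 ->
    exists2 b, is_chain D j.+1 b & boundary b = c.

Definition stoss_complex (d : nat) D : Prop :=
  [/\ is_complex D,
      (exists2 F, F \in D & #|F| = d.+1) /\
        (forall F, F \in D -> (#|F| <= d.+1)%N),
      forall F, (#|F| <= d)%N -> F \in D &
      acyclic D].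

(* set0 belongs to the lattice by convention: restriction D set0 is the complex
   with the empty face only, which is not acyclic. *)
Definition in_stoss_lattice D V : Prop := V = set0 \/ acyclic (restriction D V).

End StossComplexes.

Definition lcm_lattice_iso (K : fieldType) (n k : nat) (I : monomial_ideal K n)
    (D : {set {set 'I_k}}) : Prop :=
  exists phi : 'X_{1..n} -> {set 'I_k},
    [/\ forall m, in_lcm_lattice I m -> in_stoss_lattice K D (phi m),
        forall V, in_stoss_lattice K D V ->
          exists2 m, in_lcm_lattice I m & phi m = V &
        forall m m', in_lcm_lattice I m -> in_lcm_lattice I m' ->
          (m <= m')%MM <-> phi m \subset phi m'].

(* Main.v *)
(* Build the Taylor resolution of S/I on all subsets of the generators. When
   pdim S/I = p, its p-th syzygy module is projective and multigraded, so by graded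
   Nakayama some of the p-subsets form a basis of it. Together with all smaller
   subsets they form a stoss complex Delta that supports a resolution of S/I, whence
   every set of generators dividing a given monomial lies in the lattice of Delta.
   Multiplying the i-th generator of I by new variables Y_V, one for every V in that
   lattice with i not in V, yields an ideal J whose lcm lattice is the lattice of
   Delta, with pdim S'/J <= p, and I is obtained from J by setting all Y_V = 1.
   A Stanley decomposition of J is, up to isomorphism, a partition of a set of
   monomials into boxes; intersecting the boxes with the slice in which all Y_V have
   the same large exponent gives a decomposition for I that loses at most one
   variable per Y_V, so spdim does not increase from J to I. *)

Require Import Defs.
From mathcomp Require Import all_boot all_order all_algebra.
From HB Require Import structures.
From mathcomp Require Import generic_quotient ring_quotient zify.
From Stdlib Require Import ClassicalEpsilon.

Set Implicit Arguments.
Unset Strict Implicit.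
Unset Printing Implicit Defensive.

Import GRing.Theory.
Local Open Scope ring_scope.

(** * Projective dimension and syzygies *)

(** [pdim_le] speaks of ungraded resolutions by arbitrary projective modules, which have nothing to
    do with the Taylor resolution. A Schanuel argument transports the bound to the Taylor syzygies,
    and the splitting it provides need not respect the grading. Nakayama still applies: degrees are
    used only on the Taylor side, where a relation with a unit coefficient has a homogeneous strand
    that eliminates one subset from a minimal generating family. The variables Y_V are needed
    because the sets of generators of I dividing some monomial all lie in the lattice of Delta but
    in general do not exhaust it; the Y_V make every lattice element arise in this way while leaving
    a resolution supported on Delta. The minimality in [is_pdim] serves to give Delta its exact
    dimension and, for the module I, to turn p - 1 into its exact projective dimension. *)

Record submodule (R : comNzRingType) (A : lmodType R) := Submodule {
  sm_mem : A -> bool;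
  sm_closed : submod_closed sm_mem }.

HB.instance Definition _ (R : comNzRingType) (A : lmodType R)
    (U : submodule A) :=
  GRing.isSubmodClosed.Build R A (sm_mem U) (sm_closed U).

Record sub_of (R : comNzRingType) (A : lmodType R) (U : submodule A) := SubOf {
  sub_val : A;
  sub_valP : sm_mem U sub_val }.

HB.instance Definition _ R A U := [isSub for @sub_val R A U].
HB.instance Definition _ R A U := [Choice of @sub_of R A U by <:].
HB.instance Definition _ R A U := [SubChoice_isSubZmodule of @sub_of R A U by <:].
HB.instance Definition _ R A U := [SubZmodule_isSubLmodule of @sub_of R A U by <:].

Lemma linear_pack (R : comNzRingType) (A B : lmodType R) (f : A -> B) :
  (forall a x y, f (a *: x + y) = a *: f x + f y) ->
  exists g : {linear A -> B}, g =1 f.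
Proof.
move=> fL.
by exists (HB.pack_for {linear A -> B} f (GRing.isLinear.Build R A B *:%R f fL)).
Qed.

Lemma sub_valL (R : comNzRingType) (A : lmodType R) (U : submodule A) a
    (x y : sub_of U) :
  sub_val (a *: x + y) = a *: sub_val x + sub_val y.
Proof. exact: (linearP val). Qed.

Lemma kernel_closed (R : comNzRingType) (A B : lmodType R)
  (f : {linear A -> B}) : submod_closed (fun x => f x == 0).
Proof.
split=> [|a x y]; rewrite !unfold_in ?linear0 // => /eqP fx /eqP fy.
by rewrite linearP fx fy scaler0 addr0.
Qed.

Definition kernel (R : comNzRingType) (A B : lmodType R) (f : {linear A -> B}) :=
  Submodule (kernel_closed f).

Definition retract (R : comNzRingType) (M N : lmodType R) : Prop :=
  exists (i : {linear M -> N}) (r : {linear N -> M}), forall x, r (i x) = x.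

Section Homological.
Variable R : comNzRingType.
Implicit Types M N P Q A B : lmodType R.

(** Injectivity of [i] makes preimages unique, so the map chosen pointwise is automatically
    linear. *)
Lemma linear_factor (A B K : lmodType R) (i : {linear K -> B}) (f : {linear A -> B}) :
  injective i -> (forall x, exists y, i y = f x) ->
  exists g : {linear A -> K}, forall x, i (g x) = f x.
Proof.
move=> iI fi.
have [g0 g0E] : {g0 : A -> K | forall x, i (g0 x) = f x}.
  have ch x : {y | i y = f x} by exact: constructive_indefinite_description.
  by exists (fun x => sval (ch x)) => x; exact: (svalP (ch x)).
have [|g gE] := @linear_pack R A K g0.
  by move=> a x y; apply: iI; rewrite linearP !g0E linearP.
by exists g => x; rewrite gE.
Qed.

Lemma projective_retract M N : projective N -> retract M N -> projective M.
Proof.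
move=> pN [i [r ri]] A B g f gS.
have [h hE] := pN A B g (f \o r) gS.
by exists (h \o i) => x; rewrite /= hE /= ri.
Qed.

Lemma projective_prod M N : projective M -> projective N -> projective (M * N)%type.
Proof.
move=> pM pN A B g f gS.
have [|i1 i1E] := @linear_pack R M (M * N)%type (fun x => (x, 0)).
  by move=> a x y; congr pair; rewrite /= scaler0 addr0.
have [|i2 i2E] := @linear_pack R N (M * N)%type (fun x => (0, x)).
  by move=> a x y; congr pair; rewrite /= scaler0 addr0.
have [h1 h1E] := pM A B g (f \o i1) gS.
have [h2 h2E] := pN A B g (f \o i2) gS.
have [|h hE] := @linear_pack R (M * N)%type A (fun x => h1 x.1 + h2 x.2).
  by move=> a x y; rewrite /= !linearP scalerDr addrACA.
exists h => -[x y]; rewrite hE linearD h1E h2E /= i1E i2E -linearD.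
by rewrite [(x, 0) + _](_ : _ = (x, y)) //; congr pair; rewrite /= ?addr0 ?add0r.
Qed.

(** [projective] lifts along surjections only. The kernel of [g z.1 - f z.2] is the fibre product of
    [A] and [P] over [B]; it maps onto [P], and a section followed by the projection to [A] is the
    lift. *)
Lemma projective_lift P A B (g : {linear A -> B}) (f : {linear P -> B}) :
  projective P -> (forall x, exists a, g a = f x) ->
  exists h : {linear P -> A}, forall x, g (h x) = f x.
Proof.
move=> pP gf.
have [|u uE] := @linear_pack R (A * P)%type B (fun z => g z.1 - f z.2).
  by move=> a x y; rewrite /= linearP [f _]linearP scalerBr opprD addrACA.
pose K := sub_of (kernel u).
have [|v vE] := @linear_pack R K P (fun z => (sub_val z).2).
  by move=> a x y; rewrite sub_valL.
have [x|h hE] := pP K P v idfun.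
  have [a ga] := gf x.
  have Kax : sm_mem (kernel u) (a, x) by rewrite /= uE /= ga subrr.
  by exists (SubOf Kax); rewrite vE.
have [|w wE] := @linear_pack R P A (fun x => (sub_val (h x)).1).
  by move=> a x y; rewrite linearP sub_valL.
exists w => x; rewrite wE.
have /eqP := sub_valP (h x); rewrite /= uE => /eqP; rewrite subr_eq0 => /eqP ->.
by rewrite -vE hE.
Qed.

Lemma pdim_le0_projective M : pdim_le M 0 -> projective M.
Proof.
case=> P [delta [eps [pP P0 epsS epsK deltaK]]].
have [x y|//|g gK] := @linear_factor _ _ _ eps idfun.
  move=> exy; have /epsK[z] : eps (x - y) = 0 by rewrite linearB exy subrr.
  rewrite (P0 1%N isT z) linear0 => /esym/eqP.
  by rewrite subr_eq0 => /eqP.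
by apply: projective_retract (pP 0%N) _; exists g, eps.
Qed.

Lemma pdim_le_shift (K M P0 : lmodType R) (i : {linear K -> P0})
    (e : {linear P0 -> M}) d :
  injective i -> projective P0 -> (forall y, exists x, e x = y) ->
  (forall x, e x = 0 <-> exists y, i y = x) ->
  pdim_le K d -> pdim_le M d.+1.
Proof.
move=> iI pP0 eS eK [P [delta [eps [pP PZ epsS epsK deltaK]]]].
pose P' j : lmodType R := if j is j'.+1 then P j' else P0.
pose delta' j : {linear P' j.+1 -> P' j} :=
  if j is j'.+1 return {linear P' j.+1 -> P' j} then delta j' else i \o eps.
exists P', delta', e; split=> //.
- by case.
- by case=> [//|j] jd x; apply: PZ.
- move=> x; split=> [/eK [y <-]|[y <-]]; last by apply/eK; exists (eps y).
  by have [z <-] := epsS y; exists z.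
- case=> [|j] x; last exact: deltaK.
  rewrite /= -epsK; split=> [/eqP|->]; last by rewrite linear0.
  by rewrite -[X in _ == X](linear0 i) => /eqP /iI.
Qed.

Lemma pdim_le_syzygy M d : pdim_le M d.+1 ->
  exists (P K : lmodType R) (e : {linear P -> M}) (i : {linear K -> P}),
    [/\ projective P, pdim_le K d, injective i, forall y, exists x, e x = y
      & forall x, e x = 0 <-> exists y, i y = x].
Proof.
case=> P [delta [eps [pP PZ epsS epsK deltaK]]].
pose K := sub_of (kernel eps).
exists (P 0%N), K, eps.
have [|i iE] := @linear_pack R K (P 0%N) (@sub_val _ _ _).
  by move=> a x y; rewrite sub_valL.
exists i; split=> //.
- have kd y : sm_mem (kernel eps) (delta 0%N y) by apply/eqP/epsK; exists y.
  have [|e eE] := @linear_pack R (P 1%N) K (fun y => SubOf (kd y)).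
    by move=> a x y; apply: val_inj; rewrite /= linearP.
  exists (fun j => P j.+1), (fun j => delta j.+1), e; split=> //.
  + by move=> j dj x; apply: PZ.
  + move=> [x xK]; have /eqP/epsK [y yx] := xK.
    by exists y; rewrite eE; apply: val_inj.
  + move=> x; rewrite eE -deltaK; split=> [/(congr1 val)//|e0].
    by apply: val_inj.
- by move=> x y; rewrite !iE => /val_inj.
- move=> x; split=> [ex|[y <-]].
    have kx : sm_mem (kernel eps) x by rewrite /= ex.
    by exists (SubOf kx); rewrite iE.
  by rewrite iE; apply/eqP/(sub_valP y).
Qed.

Lemma pdim_le_projective M : projective M -> pdim_le M 0.
Proof.
move=> pM.
(* The zero module, realised as the kernel of the identity. *)
pose Z : lmodType R := sub_of (kernel (idfun : {linear M -> M})).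
have Z0 (x : Z) : x = 0 by apply: val_inj; apply/eqP/(sub_valP x).
pose P j : lmodType R := if j is 0%N then M else Z.
pose f j : {linear P j.+1 -> P j} := \0.
exists P, f, idfun; split.
- case=> [//|j] A B g h gS; exists \0 => x.
  by rewrite (Z0 x) !linear0.
- by case=> [//|j] _ x; apply: Z0.
- by move=> y; exists y.
- by move=> x; split=> [x0|[y <-] //]; exists 0; exact/esym.
- by move=> j x; split=> [_|//]; exists 0; apply/esym/(Z0 x).
Qed.

Lemma pdim_le_prod M Q d :
  pdim_le M d -> projective Q -> pdim_le (M * Q)%type d.
Proof.
case: d => [|d] hM pQ.
  by apply/pdim_le_projective/projective_prod => //; apply: pdim_le0_projective.
have [P [K [e [i [pP hK iI eS eK]]]]] := pdim_le_syzygy hM.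
have [|e' e'E] := @linear_pack R (P * Q)%type (M * Q)%type
    (fun z => (e z.1, z.2)).
  by move=> a x y; rewrite /= linearP.
have [|i' i'E] := @linear_pack R K (P * Q)%type (fun z => (i z, 0)).
  by move=> a x y; rewrite linearP; congr pair; rewrite /= scaler0 addr0.
apply: (pdim_le_shift (i := i') (e := e')) hK.
- by move=> x y; rewrite !i'E => -[/iI].
- exact: projective_prod.
- by move=> [y q]; have [x ex] := eS y; exists (x, q); rewrite e'E /= ex.
- move=> [x q]; rewrite e'E; split=> [[/eK [y yx] /= ->]|[y]].
    by exists y; rewrite i'E yx.
  by rewrite i'E => -[<- <-]; congr pair; apply/eK; exists y.
Qed.

(* Schanuel's lemma in the form "syzygies of retracts are retracts of syzygies",
   which avoids cancelling projective summands. *)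
Definition retract_pdim_le M d : Prop := exists2 N, pdim_le N d & retract M N.

Lemma pdim_le_retract M d : pdim_le M d -> retract_pdim_le M d.
Proof. by exists M => //; exists idfun, idfun. Qed.

Lemma retract_pdim_le0 M : retract_pdim_le M 0 -> projective M.
Proof. by case=> N /pdim_le0_projective /projective_retract; apply. Qed.

Lemma retract_pdim_le_syzygy (K M P : lmodType R) (i : {linear K -> P})
    (e : {linear P -> M}) d :
  injective i -> projective P -> (forall y, exists x, e x = y) ->
  (forall x, e x = 0 <-> exists y, i y = x) ->
  retract_pdim_le M d.+1 -> retract_pdim_le K d.
Proof.
move=> iI pP eS eK [N /pdim_le_syzygy].
move=> [P' [K' [e' [i' [pP' hK' i'I e'S e'K]]]]] [s [r rs]].
exists (K' * P)%type; first exact: pdim_le_prod.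
have [x|a aE] := projective_lift (g := e') (f := s \o e) pP; first exact: e'S.
have [x|b bE] := projective_lift (g := e) (f := r \o e') pP'; first exact: eS.
rewrite /= in aE bE.
have [y|f fE] := linear_factor (f := a \o i) i'I.
  by apply/e'K; rewrite /= aE (iffRL (eK _)) ?linear0 //; exists y.
(* Since [b] after [a] lifts the identity of [M], the difference [z.2 - b (a z.2)] lies in the
   syzygy [K], and so does [b (i' z.1)]. At [(f y, i y)] the terms with [b] cancel and [i y]
   remains, which makes [g] a retraction. *)
have [|u uE] := @linear_pack R (K' * P)%type P
    (fun z => b (i' z.1) + (z.2 - b (a z.2))).
  move=> c x y; rewrite /= !linearP /= !scalerDr.
  by rewrite [c *: x.2 + _ + _]addrACA [RHS]addrACA.
have [z|g gE] := linear_factor (f := u) iI.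
  apply/eK; rewrite uE linearD linearB !bE aE rs subrr addr0.
  by rewrite (iffRL (e'K _)) ?linear0 //; exists z.1.
have [|h hE] := @linear_pack R K (K' * P)%type (fun y => (f y, i y)).
  by move=> c x y; rewrite !linearP.
exists h, g => y; apply: iI.
by rewrite gE uE hE /= fE /= addrC subrK.
Qed.

End Homological.

(** The coordinates need not be unique and some [e i] may vanish, so the Taylor modules can be
    indexed by all subsets, whatever [D] and the cardinality. *)
Lemma dual_basis_projective (R : comNzRingType) (P : lmodType R) (I : finType)
    (e : I -> P) (x : I -> P -> R) :
  (forall i a p q, x i (a *: p + q) = a * x i p + x i q) ->
  (forall p, p = \sum_i x i p *: e i) -> projective P.
Proof.
move=> xL xE A B g f gS.
have [b bE] : {b : I -> A | forall i, g (b i) = f (e i)}.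
  have ch i : {y | g y = f (e i)} by exact: constructive_indefinite_description.
  by exists (fun i => sval (ch i)) => i; exact: (svalP (ch i)).
have [|h hE] := @linear_pack R P A (fun p => \sum_i x i p *: b i).
  move=> a p q; rewrite scaler_sumr -big_split; apply: eq_bigr => i _.
  by rewrite xL scalerDl scalerA.
exists h => p; rewrite hE linear_sum [in RHS](xE p) linear_sum.
by apply: eq_bigr => i _; rewrite !linearZ /= bE.
Qed.

(* Graded Nakayama: [N] is a direct summand contained in [m P]; since [rho] maps
   [m^j P] into [m^j P], iterating gives [N] inside every [m^j P]. *)
Lemma summand_in_max_eq0 (K : fieldType) (n : nat)
    (P : lmodType {mpoly K[n]}) (I : finType) (e : I -> P)
    (x : I -> P -> {mpoly K[n]}) (rho : {linear P -> P}) (N : P -> Prop) :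
  (forall i a p q, x i (a *: p + q) = a * x i p + x i q) ->
  (forall p, p = \sum_i x i p *: e i) ->
  (forall p, N (rho p)) -> (forall p, N p -> rho p = p) ->
  (forall p i, N p -> (x i p)@_0%MM = 0) ->
  forall p, N p -> p = 0.
Proof.
move=> xL xE Nrho rhoN N0 p Np.
have x0 i : x i 0 = 0.
  have := xL i 1 0 0; rewrite scaler0 add0r mul1r -[LHS]addr0.
  by move/addrI/esym.
have ord j : forall p, N p -> forall i a, (x i p)@_a != 0 -> (j <= mdeg a)%N.
  elim: j => // j IH q Nq i a.
  rewrite -{1}(rhoN _ Nq) (xE q) linear_sum.
  have -> : x i (\sum_l rho (x l q *: e l)) = \sum_l x l q * x i (rho (e l)).
    apply: (big_ind2 (fun u v => x i u = v)) => //.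
    - by move=> u u' v v' <- <-; have := xL i 1 u v; rewrite scale1r mul1r.
    - by move=> l _; rewrite linearZ /= -[_ *: _]addr0 xL x0 addr0.
  rewrite -mcoeff_msupp => /msupp_sum_le/flattenP[s /mapP[l _ ->]].
  move=> /msuppM_le/allpairsP[[b c] /= [bs cs ->]].
  rewrite mdegD -add1n leq_add //.
    rewrite lt0n mdeg_eq0; apply: contraTneq bs => ->.
    by rewrite mcoeff_msupp N0 ?eqxx.
  by apply: (IH _ (Nrho (e l)) i); rewrite -mcoeff_msupp.
rewrite (xE p) big1 // => i _.
suff -> : x i p = 0 by rewrite scale0r.
apply/mpolyP => a; rewrite mcoeff0; apply/eqP/negPn/negP => h.
by have := ord (mdeg a).+1 _ Np _ _ h; rewrite ltnn.
Qed.

Lemma regular_projective (R : comNzRingType) : projective R^o.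
Proof.
apply: (@dual_basis_projective R R^o 'I_1 (fun _ => 1) (fun _ x => x)) => //.
by move=> p; rewrite big_ord1 [RHS]mulr1.
Qed.

Section IdealResolution.
Variables (R : comNzRingType) (I : idealr R).

Lemma ideal_embedding : exists (i : {linear ideal_module I -> R^o})
    (e : {linear R^o -> {ideal_quot I}}),
  [/\ i =1 @ideal_val _ _, injective i, forall y, exists x, e x = y &
      forall x, e x = 0 <-> exists y, i y = x].
Proof.
have [//|i iE] := @linear_pack R (ideal_module I) R^o (@ideal_val _ _).
have [|e eE] := @linear_pack R R^o {ideal_quot I} (\pi_{ideal_quot I}%qT).
  by move=> a x y; rewrite rmorphD rmorphM.
exists i, e; split=> //.
- by move=> x y; rewrite !iE => xy; apply: val_inj.
- by move=> y; exists (repr y); rewrite eE reprK.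
- move=> x; rewrite eE.
  have -> : \pi_{ideal_quot I}%qT x = 0 <-> x \in (I : {pred R}).
    rewrite -[X in X \in _]subr0 Quotient.idealrBE.
    have e0 : \pi_{ideal_quot I}%qT 0 = 0 := rmorph0 (\pi_{ideal_quot I}%qT).
    by split=> [h|/eqP h]; [apply/eqP|]; rewrite h e0.
  split=> [xI|[y <-]]; last by rewrite iE; exact: ideal_valP.
  by exists (@IdealModule R I x xI); rewrite iE.
Qed.

Lemma pdim_le_quotient d :
  pdim_le (ideal_module I) d -> pdim_le {ideal_quot I} d.+1.
Proof.
have [i [e [_ iI eS eK]]] := ideal_embedding.
exact: pdim_le_shift iI (@regular_projective R) eS eK.
Qed.

Lemma retract_pdim_le_ideal d :
  pdim_le {ideal_quot I} d.+1 -> retract_pdim_le (ideal_module I) d.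
Proof.
have [i [e [_ iI eS eK]]] := ideal_embedding.
move=> /pdim_le_retract.
exact: retract_pdim_le_syzygy iI (@regular_projective R) eS eK.
Qed.

End IdealResolution.

(** * Simplicial chains and stoss complexes *)

Section SimplicialChains.
Variables (k : nat).
Implicit Types (F G V : {set 'I_k}) (v w : 'I_k).

Definition eps v F : nat := #|[set u in F | (u < v)%N]|.

(** [boundary] reindexed by the vertices that can be added to [G]. The general ring [R] serves
    chains over [K] and, with polynomial coefficients, the Taylor differential. *)
Definition bdry (R : comNzRingType) (c : {set 'I_k} -> R) G : R :=
  \sum_(v | v \notin G) (-1) ^+ eps v G * c (v |: G).

(** Coning with apex [v], the contracting homotopy of the full simplex. *)
Definition cone (R : comNzRingType) v (c : {set 'I_k} -> R) F : R :=
  if v \in F then (-1) ^+ eps v F * c (F :\ v) else 0.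

Lemma eps_setU1 v w G : v \notin G -> eps w (v |: G) = ((v < w)%N + eps w G)%N.
Proof.
move=> vG; rewrite /eps -!sum1_card.
have split_set (A : {set 'I_k}) : (\sum_(i in [set u in A | (u < w)%N]) 1 =
    \sum_(i in A) (i < w)%N)%N.
  by rewrite big_mkcond [RHS]big_mkcond; apply: eq_bigr => i _;
    rewrite !inE; case: (i \in A); case: ltnP.
by rewrite !split_set big_setU1.
Qed.

Lemma sign_setU1C (R : comNzRingType) v w G :
  v != w -> v \notin G -> w \notin G ->
  (-1) ^+ eps v G * (-1) ^+ eps w (v |: G) =
  - ((-1) ^+ eps w G * (-1) ^+ eps v (w |: G)) :> R.
Proof.
move=> vw vG wG; rewrite !eps_setU1 // !exprD.
have [lt|lt|/val_inj e] := ltngtP v w; last by rewrite e eqxx in vw.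
  by rewrite expr1 expr0 mul1r mulN1r mulrN mulrC.
by rewrite expr1 expr0 mul1r mulN1r mulrN opprK mulrC.
Qed.

Lemma boundaryE (K : fieldType) (c : {ffun {set 'I_k} -> K}) G :
  boundary c G = bdry c G.
Proof.
rewrite ffunE (exchange_big_dep xpredT) //= /bdry [RHS]big_mkcond.
apply: eq_bigr => v _; case: ifPn => [vG|/negPn vG].
  rewrite (big_pred1 (v |: G)) => [|F] /=.
    by congr (_ ^+ _ * _); rewrite -/(eps v _) eps_setU1 // ltnn.
  apply/andP/eqP => [[vF /eqP <-]|->]; first by rewrite setD1K.
  by rewrite setU11 setU1K.
by rewrite big_pred0 // => F; apply/negbTE/negP => /andP[_ /eqP e];
  rewrite -e !inE eqxx in vG.
Qed.

Variable R : comNzRingType.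
Implicit Types c : {set 'I_k} -> R.

Lemma eq_bdry c c' G : c =1 c' -> bdry c G = bdry c' G.
Proof. by move=> cc'; apply: eq_bigr => v _; rewrite cc'. Qed.

Lemma bdry_linear (a : R) c c' G :
  bdry (fun F => a * c F + c' F) G = a * bdry c G + bdry c' G.
Proof.
rewrite /bdry mulr_sumr -big_split; apply: eq_bigr => v _.
by rewrite mulrDr mulrCA.
Qed.

Lemma bdry0 c G : (forall F, c F = 0) -> bdry c G = 0.
Proof. by move=> c0; apply: big1 => v _; rewrite c0 mulr0. Qed.

Lemma bdry_bdry c G : bdry (bdry c) G = 0.
Proof.
rewrite /bdry; under eq_bigr => v _ do rewrite mulr_sumr.
pose f (v w : 'I_k) : R :=
  if [&& v != w, v \notin G & w \notin G] then
    (-1) ^+ eps v G * (-1) ^+ eps w (v |: G) * c (w |: (v |: G)) else 0.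
have -> : \sum_(v | v \notin G) \sum_(w | w \notin v |: G)
    (-1) ^+ eps v G * ((-1) ^+ eps w (v |: G) * c (w |: (v |: G))) =
    \sum_v \sum_w f v w.
  rewrite big_mkcond; apply: eq_bigr => v _; case: ifPn => vG; last first.
    by rewrite big1 // => w _; rewrite /f (negbTE vG) /= andbF.
  rewrite big_mkcond; apply: eq_bigr => w _.
  by rewrite /f vG !inE negb_or eq_sym /= mulrA.
have fC v w : f v w = - f w v.
  rewrite /f eq_sym [(v \notin G) && _]andbC.
  case: ifPn => [/and3P[vw wG vG]|_]; last by rewrite oppr0.
  by rewrite sign_setU1C // 1?eq_sym // mulNr setUCA.
have fvv v : f v v = 0 by rewrite /f eqxx.
(* Antisymmetry alone proves nothing in characteristic 2, so the pairs with v < w are cancelled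
   against those with v > w, and the diagonal vanishes by definition of [f]. *)
rewrite pair_big /= (bigID (fun z : 'I_k * 'I_k => (z.1 < z.2)%N)) /=.
rewrite [X in _ + X](bigID (fun z : 'I_k * 'I_k => (z.2 < z.1)%N)) /=.
rewrite [X in _ + (_ + X)]big1 => [|[v w] /= /andP[]]; last first.
  by case: ltngtP => // /val_inj -> _ _.
rewrite addr0 [X in _ + X](reindex_inj
  (h := fun z : 'I_k * 'I_k => (z.2, z.1))) /=; last first.
  by move=> [a b] [a' b'] /= [-> ->].
rewrite -[RHS](subrr (\sum_(i : 'I_k * 'I_k | (i.1 < i.2)%N) f i.1 i.2)) -sumrN.
congr (_ + _); apply: eq_big => [[v w]|[v w] _] /=; last by rewrite fC.
by case: ltngtP.
Qed.

(** For v outside G only the added vertex v contributes. For v in G the term that removes and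
    restores v gives [c G], and the other terms cancel in pairs by the sign rule. *)
Lemma bdry_cone v c G : bdry (cone v c) G + cone v (bdry c) G = c G.
Proof.
rewrite /cone; case: ifPn => vG; last first.
  rewrite addr0 /bdry (bigD1 v) //= setU11 setU1K // big1 ?addr0 => [|w].
    by rewrite eps_setU1 // ltnn mulrA -exprD addnn -muln2 exprM sqrr_sign mul1r.
  by case/andP=> wG wv; rewrite !inE eq_sym (negbTE wv) (negbTE vG) mulr0.
have vG' : v \notin G :\ v by rewrite !inE eqxx.
have epsG w : eps w G = ((v < w)%N + eps w (G :\ v))%N.
  by rewrite -eps_setU1 // setD1K.
rewrite /bdry [in X in _ + X](bigD1 v) //= setD1K // mulrDr mulrA epsG ltnn add0n.
rewrite -exprD addnn -muln2 exprM sqrr_sign mul1r addrCA -[RHS]addr0; congr (_ + _).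
rewrite mulr_sumr /= [X in _ + X](eq_bigl (fun w => w \notin G)); last first.
  by move=> w; rewrite !inE negb_and negbK; case: (w =P v) => [->|_] /=;
    rewrite ?vG ?andbT.
rewrite -big_split big1 //= => w wG.
have wv : w != v by apply: contraNneq wG => ->.
rewrite !inE vG orbT eps_setU1 //.
have -> : (w |: G) :\ v = w |: (G :\ v).
  by apply/setP => u; rewrite !inE; case: (u =P w) => [->|_]; rewrite ?wv.
rewrite !mulrA -mulrDl -[RHS](mul0r (c (w |: (G :\ v)))); congr (_ * _).
rewrite !epsG ltnn !exprD.
have [lt|lt|/val_inj e] := ltngtP v w; last by rewrite e eqxx in wv.
  by rewrite expr1 expr0 !mul1r !mulN1r mulNr mulrC addNr.
by rewrite expr1 expr0 !mul1r !mulN1r mulrN mulrC addNr.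
Qed.

End SimplicialChains.

(** * Acyclic restrictions and the lattice of a stoss complex *)

Section ChainsOfComplexes.
Variables (K : fieldType) (k : nat).
Implicit Types (D : {set {set 'I_k}}) (F G V W : {set 'I_k}).
Implicit Types c b : {ffun {set 'I_k} -> K}.

Lemma is_chainW D D' j c :
  {subset D <= D'} -> is_chain D j c -> is_chain D' j c.
Proof. by move=> sD hc F /hc[/sD]. Qed.

Lemma restriction_complex D V : is_complex D -> is_complex (restriction D V).
Proof.
move=> cD F G; rewrite !inE => /andP[FD FV] GF.
by rewrite (cD F) // (subset_trans GF FV).
Qed.

Lemma restriction_setT D : restriction D setT = D.
Proof. by apply/setP => F; rewrite inE subsetT andbT. Qed.

Lemma boundary_chain D j c :
  is_complex D -> is_chain D j.+1 c -> is_chain D j (boundary c).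
Proof.
move=> cD hc G; rewrite boundaryE => nz.
have /existsP[v /andP[vG cv]] : [exists v, (v \notin G) && (c (v |: G) != 0)].
  apply: contraNT nz => /existsPn h.
  rewrite /bdry big1 // => v vG; have := h v; rewrite vG /= negbK => /eqP ->.
  by rewrite mulr0.
have [vGD] := hc _ cv; rewrite cardsU1 vG => -[card_G]; split=> //.
exact: cD vGD (subsetU1 v G).
Qed.

Lemma boundary_cone v c :
  boundary c = 0 -> boundary [ffun F => cone v c F] = c.
Proof.
move=> c0; apply/ffunP => G; rewrite boundaryE -[RHS](bdry_cone v).
rewrite [X in _ + X](_ : _ = 0) ?addr0; first by apply: eq_bdry => F; rewrite ffunE.
by rewrite /cone; case: ifP => // _; rewrite -boundaryE c0 ffunE mulr0.
Qed.

Lemma cone_supp v c F : cone v c F != 0 -> v \in F /\ c (F :\ v) != 0.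
Proof.
rewrite /cone; case: ifP => [vF|]; last by rewrite eqxx.
by move=> h; split=> //; apply: contraNneq h => ->; rewrite mulr0.
Qed.

Lemma boundary0 : boundary (0 : {ffun {set 'I_k} -> K}) = 0.
Proof.
by apply/ffunP => G; rewrite boundaryE ffunE bdry0 // => F; rewrite ffunE.
Qed.

Lemma boundaryB c b : boundary (c - b) = boundary c - boundary b.
Proof.
have addE x y : boundary (x + y) = boundary x + boundary y.
  apply/ffunP => G; rewrite boundaryE [RHS]ffunE !boundaryE -[bdry x G]mul1r.
  by rewrite -bdry_linear; apply: eq_bdry => F; rewrite ffunE mul1r.
by apply: (addIr (boundary b)); rewrite -addE !subrK.
Qed.

(* A complex with complete (q-1)-skeleton and no q-cycles can only have homology
   in dimension q-1, since all lower cycles are filled by cones. *)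
Lemma acyclic_restriction q D V :
  (forall F, (#|F| <= q)%N -> F \in D) -> (forall F, F \in D -> (#|F| <= q.+1)%N) ->
  V != set0 ->
  (forall c, is_chain (restriction D V) q c -> boundary c = 0 ->
    exists2 b, is_chain (restriction D V) q.+1 b & boundary b = c) ->
  (forall c, is_chain (restriction D V) q.+1 c -> boundary c = 0 -> c = 0) ->
  acyclic K (restriction D V).
Proof.
move=> skel dimD /set0Pn[v vV] fill top j c hc c0.
have [jq|qj|jq] := ltngtP j q; last by rewrite jq in hc *; apply: fill.
  exists [ffun F => cone v c F]; last exact: boundary_cone.
  move=> F; rewrite ffunE => /cone_supp[vF /hc[]]; rewrite inE => /andP[_ FV] cF.
  have cardF : #|F| = j.+1 by rewrite (cardsD1 v F) vF cF.
  split=> //; rewrite inE skel ?cardF //=.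
  by rewrite -(setD1K vF) subUset sub1set vV.
have -> : c = 0.
  have [jq|jq] := eqVneq j q.+1; first by rewrite jq in hc; apply: top.
  apply/ffunP => F; rewrite ffunE; apply/eqP/negPn/negP => /hc[].
  rewrite inE => /andP[/dimD leF _] cF.
  by rewrite cF leq_eqVlt (negbTE jq) ltnS leqNgt qj in leF.
exists 0; last exact: boundary0.
by move=> F; rewrite ffunE eqxx.
Qed.

Variables (q : nat) (D : {set {set 'I_k}}).
Hypothesis stossD : stoss_complex K q D.

Let skelD F : (#|F| <= q)%N -> F \in D.
Proof. by case: stossD => _ _ skel _ /skel. Qed.

Let dimD F : F \in D -> (#|F| <= q.+1)%N.
Proof. by case: stossD => _ [_ dim] _ _ /dim. Qed.

(** Acyclicity of the whole complex makes a top cycle the boundary of a chain one dimension higher,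
    where there are no faces. *)
Lemma stoss_top_cycle V c :
  is_chain (restriction D V) q.+1 c -> boundary c = 0 -> c = 0.
Proof.
move=> hc c0; case: stossD => _ _ _ ac.
have [|b hb <-] := ac q.+1 c _ c0.
  by apply: is_chainW hc => F; rewrite inE => /andP[].
suff -> : b = 0 by apply: boundary0.
apply/ffunP => F; rewrite ffunE; apply/eqP/negPn/negP => /hb[/dimD leF cF].
by rewrite cF ltnn in leF.
Qed.

(** A cycle on the intersection has a filling inside V and one inside W. Both are top-dimensional,
    so their difference is a top cycle, hence 0; the common filling lives on the intersection. *)
Lemma stoss_lattice_setI V W :
  in_stoss_lattice K D V -> in_stoss_lattice K D W ->
  in_stoss_lattice K D (V :&: W).
Proof.
case=> [->|acV]; first by left; rewrite set0I.
case=> [->|acW]; first by left; rewrite setI0.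
have [->|nz] := eqVneq (V :&: W) set0; first by left.
right; apply: acyclic_restriction skelD dimD nz _ (@stoss_top_cycle _).
move=> c hc c0.
have [|b hb bc] := acV q c _ c0.
  apply: is_chainW hc => F; rewrite !inE subsetI => /andP[-> /andP[-> _]] //.
have [|b' hb' bc'] := acW q c _ c0.
  apply: is_chainW hc => F; rewrite !inE subsetI => /andP[-> /andP[_ ->]] //.
have bb' : b = b'.
  apply/eqP; rewrite -subr_eq0; apply/eqP/(@stoss_top_cycle setT); last first.
    by rewrite boundaryB bc bc' subrr.
  rewrite restriction_setT => F; rewrite !ffunE => nzF.
  have [/hb[]|b0] := boolP (b F != 0); first by rewrite inE => /andP[-> _].
  have [/hb'[]|b'0] := boolP (b' F != 0); first by rewrite inE => /andP[-> _].
  by move: b0 b'0 nzF; rewrite !negbK => /eqP -> /eqP ->; rewrite subrr eqxx.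
exists b => // F nzF; have [] := hb F nzF; rewrite !inE subsetI => /andP[-> ->] ->.
by rewrite bb' in nzF; have [] := hb' F nzF; rewrite inE => /andP[_ ->].
Qed.

Lemma stoss_lattice_setT : in_stoss_lattice K D setT.
Proof. by right; rewrite restriction_setT; case: stossD. Qed.

(** It is what makes the generators of the constructed ideal pairwise incomparable. For positive [q]
    the cone over [c] with apex [i] is 0, since a nonempty subset of the singleton cannot avoid
    [i]. *)
Lemma stoss_lattice_set1 i : (0 < q)%N -> in_stoss_lattice K D [set i].
Proof.
move=> q0; right; apply: acyclic_restriction skelD dimD _ _ (@stoss_top_cycle _).
  by apply/set0Pn; exists i; rewrite inE.
move=> c hc c0; exists [ffun F => cone i c F]; last exact: boundary_cone.
move=> F; rewrite ffunE => /cone_supp[iF /hc[]].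
rewrite inE => /andP[_ /subsetP sF] cF.
suff F0 : F :\ i = set0 by rewrite -cF F0 cards0 in q0.
apply/setP => u; rewrite in_set0; apply/negbTE/negP => uF.
by have := sF _ uF; move: uF; rewrite !inE => /andP[/negbTE ->].
Qed.

Lemma stoss_lattice_bigcap (P : pred {set 'I_k}) :
  (forall V, P V -> in_stoss_lattice K D V) ->
  in_stoss_lattice K D (\bigcap_(V | P V) V).
Proof.
move=> PL; apply: (big_ind (fun V => in_stoss_lattice K D V)) => //.
- exact: stoss_lattice_setT.
- exact: stoss_lattice_setI.
Qed.

End ChainsOfComplexes.

(** * The Taylor resolution *)

Section TaylorModules.
Variables (K : fieldType) (n k : nat) (g : 'I_k -> 'X_{1..n}).
Local Notation S := {mpoly K[n]}.
Local Notation chains := {ffun {set 'I_k} -> S^o}.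
Implicit Types (D : {set {set 'I_k}}) (F G : {set 'I_k}) (a b : 'X_{1..n}).

Definition below a : {set 'I_k} := [set i | (g i <= a)%MM].

Lemma below_mono a b : (a <= b)%MM -> below a \subset below b.
Proof.
by move=> ab; apply/subsetP => i; rewrite !inE => /lepm_trans; apply.
Qed.

Definition lab F : 'X_{1..n} := foldr (@mlcm n) 0%MM [seq g i | i <- enum F].

Lemma lem_foldr_mlcm (s : seq 'X_{1..n}) a :
  (foldr (@mlcm n) 0%MM s <= a)%MM = all (fun m => (m <= a)%MM) s.
Proof.
elim: s => [|m s IH] /=; last by rewrite lem_mlcm IH.
by apply/mnm_lepP => i; rewrite mnm0E.
Qed.

(** A Galois connection between sets of generators and monomials; its closed sets, ordered by
    inclusion, form the lcm lattice when [g] lists the minimal generators. *)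
Lemma lem_lab F a : (lab F <= a)%MM = (F \subset below a).
Proof.
rewrite /lab lem_foldr_mlcm all_map; apply/allP/subsetP => h i.
  by move=> iF; rewrite inE; apply: h; rewrite mem_enum.
by rewrite mem_enum => /h; rewrite inE.
Qed.

Definition strand a (c : chains) : {ffun {set 'I_k} -> K} :=
  [ffun F => (c F : S)@_a].

Lemma strandP (c c' : chains) : (forall a, strand a c = strand a c') -> c = c'.
Proof.
move=> h; apply/ffunP => F; apply/mpolyP => a.
by have := congr1 (fun f : {ffun _ -> _} => f F) (h a); rewrite !ffunE.
Qed.

Definition lift a (x : {ffun {set 'I_k} -> K}) : chains :=
  [ffun F => x F *: 'X_[a]].

Lemma strand_lift a b x : strand b (lift a x) = if b == a then x else 0.
Proof.
apply/ffunP => F; rewrite !ffunE mcoeffZ mcoeffX eq_sym.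
by case: eqP => _; rewrite ?ffunE ?mulr1 ?mulr0.
Qed.

Lemma lift0 a : lift a 0 = 0.
Proof. by apply/ffunP => F; rewrite !ffunE scale0r. Qed.

Lemma bd_exists : {bd : {linear chains -> chains} |
  forall c G, bd c G = bdry (c : {set 'I_k} -> S) G}.
Proof.
apply: constructive_indefinite_description.
have [|f fE] := @linear_pack S chains chains
   (fun c => [ffun G => bdry (c : {set 'I_k} -> S) G]).
  move=> x c c'; apply/ffunP => G; rewrite !ffunE -bdry_linear.
  by apply: eq_bdry => F; rewrite !ffunE.
by exists f => c G; rewrite fE ffunE.
Qed.

Definition bd : {linear chains -> chains} := sval bd_exists.

Lemma bdE c G : bd c G = bdry (c : {set 'I_k} -> S) G.
Proof. exact: (svalP bd_exists). Qed.

Lemma strand_bd a c : strand a (bd c) = boundary (strand a c).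
Proof.
apply/ffunP => G; rewrite boundaryE ffunE bdE /bdry raddf_sum.
apply: eq_bigr => v _ /=; rewrite ffunE.
have -> : (-1 : S) = (-1)%:MP by rewrite mpolyCN mpolyC1.
by rewrite -rmorphXn mcoeffCM.
Qed.

Lemma bd_bd c : bd (bd c) = 0.
Proof.
apply/ffunP => G; rewrite bdE ffunE -[RHS](bdry_bdry (c : {set 'I_k} -> S) G).
by apply: eq_bdry => F; rewrite bdE.
Qed.

Lemma bd_lift a x : bd (lift a x) = lift a (boundary x).
Proof.
apply: strandP => b; rewrite strand_bd !strand_lift.
by case: eqP => // _; rewrite boundary0.
Qed.

(* The i-th Taylor module, restricted to the sets in D: the coefficient of the
   basis element F is written as an element of the ideal generated by the label
   of F, so that the differential is the simplicial boundary with constant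
   coefficients and the strand of degree a is a chain on the vertices whose
   label divides a. *)
Definition tay_mem D i (c : chains) : bool :=
  [forall F, all (fun a => [&& F \in D, #|F| == i & F \subset below a])
    (msupp (c F : S))].

Lemma tay_memP D i c :
  tay_mem D i c <-> forall a, is_chain (restriction D (below a)) i (strand a c).
Proof.
split=> [/forallP h a F|h].
  rewrite ffunE => nz; have /allP /(_ a) := h F.
  rewrite mcoeff_msupp => /(_ nz) /and3P[FD /eqP cF Fa].
  by rewrite inE FD Fa.
apply/forallP => F; apply/allP => a; rewrite mcoeff_msupp => nz.
have := h a F; rewrite ffunE => /(_ nz) [].
by rewrite inE => /andP[-> ->] ->; rewrite eqxx.
Qed.

Lemma tay_closed D i : submod_closed (tay_mem D i).
Proof.
split=> [|x c c' /tay_memP hc /tay_memP hc'].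
  by apply/tay_memP => a F; rewrite !ffunE mcoeff0 eqxx.
apply/tay_memP => a F; rewrite !ffunE -mcoeff_msupp.
move=> /msuppD_le; rewrite mem_cat => /orP[|]; last first.
  by move=> nz; apply: hc'; rewrite ffunE -mcoeff_msupp.
move=> /msuppM_le/allpairsP[[b b'] /= [_ nz ->]].
have [|] := hc b' F; first by rewrite ffunE -mcoeff_msupp.
rewrite !inE => /andP[-> sF] ->; split=> //=.
exact/(subset_trans sF)/below_mono/lem_addl.
Qed.

Definition tay D i : submodule chains := Submodule (tay_closed D i).

Lemma tay_bd D i c :
  is_complex D -> tay_mem D i.+1 c -> tay_mem D i (bd c).
Proof.
move=> cD /tay_memP hc; apply/tay_memP => a; rewrite strand_bd.
exact/boundary_chain/hc/restriction_complex.
Qed.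

Lemma tay_lift D i a x :
  is_chain (restriction D (below a)) i x -> tay_mem D i (lift a x).
Proof.
move=> hx; apply/tay_memP => b; rewrite strand_lift; case: eqP => [->//|_].
by move=> F; rewrite ffunE eqxx.
Qed.

(** Exactness is checked one multidegree at a time: only the finitely many degrees in [s] occur in
    [c], and the lifted fillings of its strands add up to a filling. *)
Lemma tay_fill D i c :
  (forall a, exists2 x, is_chain (restriction D (below a)) i.+1 x &
     boundary x = strand a c) ->
  exists2 c', tay_mem D i.+1 c' & bd c' = c.
Proof.
move=> fill.
pose s := undup (flatten [seq msupp (c F : S) | F <- enum {: {set 'I_k}}]).
have -> : c = \sum_(a <- s) lift a (strand a c).
  apply/ffunP => F; apply/mpolyP => a; rewrite sum_ffunE raddf_sum /=.
  transitivity (\sum_(b <- s) (c F : S)@_b * (b == a)%:R).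
    have [as_|as_] := boolP (a \in s).
      rewrite (bigD1_seq a) ?undup_uniq //= eqxx mulr1 big1 ?addr0 // => b.
      by move=> /negbTE ->; rewrite mulr0.
    rewrite big1_seq => [|b /andP[_ bs]].
      apply: memN_msupp_eq0; apply: contra as_ => aF; rewrite mem_undup.
      by apply/flattenP; exists (msupp (c F : S)) => //; apply: map_f; rewrite mem_enum.
    by case: eqP => [e|]; [rewrite -e bs in as_ | rewrite mulr0].
  by apply: eq_bigr => b _; rewrite !ffunE mcoeffZ mcoeffX.
elim: s => [|a s [c' hc' bc']].
  exists 0; last by rewrite big_nil linear0.
  exact: (tay_closed D i.+1).1.
have [x hx bx] := fill a.
exists (1 *: lift a x + c').
  by apply: (tay_closed D i.+1).2 => //; apply: tay_lift.
by rewrite big_cons linearP scale1r bc' bd_lift bx.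
Qed.

(** In a degree outside the ideal the restriction may consist of the empty face alone, which is not
    acyclic; such strands are required to vanish instead. *)
Lemma tay_exact D i c :
  (forall a, below a != set0 -> acyclic K (restriction D (below a))) ->
  (forall a, below a = set0 -> strand a c = 0) ->
  tay_mem D i c -> bd c = 0 -> exists2 c', tay_mem D i.+1 c' & bd c' = c.
Proof.
move=> acD c0 /tay_memP hc bc; apply: tay_fill => a.
have [/c0 ->|nz] := eqVneq (below a) set0.
  by exists 0; [move=> F; rewrite ffunE eqxx | apply: boundary0].
apply: (acD a nz) => //; rewrite -strand_bd bc.
by apply/ffunP => F; rewrite !ffunE mcoeff0.
Qed.

Lemma strand_below0 D i a c :
  tay_mem D i.+1 c -> below a = set0 -> strand a c = 0.
Proof.
move=> /tay_memP hc a0; apply/ffunP => F; rewrite [RHS]ffunE.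
apply/eqP/negPn/negP => /hc[]; rewrite inE a0 subset0 => /andP[_ /eqP ->].
by rewrite cards0.
Qed.

(** The quotient of [f] by ['X_[a]]. Subtraction of exponents is truncated, so it is meaningful only
    when ['X_[a]] divides every term. *)
Definition divX a (f : S) : S := \sum_(b <- msupp f) f@_b *: 'X_[b - a].

Lemma divXK a (f : S) :
  (forall b, f@_b != 0 -> (a <= b)%MM) -> 'X_[a] * divX a f = f.
Proof.
move=> h; rewrite [RHS]mpolyE /divX mulr_sumr big_seq [RHS]big_seq.
apply: eq_bigr => b; rewrite mcoeff_msupp => /h ab.
by rewrite -scalerAr -mpolyXD addmC submK.
Qed.

Lemma mpolyX_neq0 a : 'X_[a] != 0 :> S.
Proof.
by apply/eqP => /mpolyP /(_ a); rewrite mcoeffX eqxx mcoeff0 => /eqP;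
  rewrite oner_eq0.
Qed.

Definition tay_coord D i F (c : sub_of (tay D i)) : S :=
  divX (lab F) (sub_val c F).

(** The default of [insubd] is never reached, by [tay_basis_val]. The element is 0 if [F] is not in
    [D] or has the wrong size, which keeps the index type independent of [D] and [i]. *)
Definition tay_basis D i F : sub_of (tay D i) :=
  insubd 0 (lift (lab F) [ffun G => ((G == F) && (F \in D) && (#|F| == i))%:R]).

Lemma tay_coordK D i F (c : sub_of (tay D i)) :
  'X_[lab F] * tay_coord F c = sub_val c F.
Proof.
apply: divXK => b nz; have /tay_memP/(_ b F) := sub_valP c.
by rewrite ffunE => /(_ nz)[]; rewrite inE lem_lab => /andP[].
Qed.

Lemma tay_coord_linear D i F x (c c' : sub_of (tay D i)) :
  tay_coord F (x *: c + c') = x * tay_coord F c + tay_coord F c'.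
Proof.
apply: (mulfI (mpolyX_neq0 (lab F))); rewrite mulrDr mulrCA !tay_coordK.
by rewrite sub_valL !ffunE.
Qed.

Lemma tay_basis_val D i F : sub_val (tay_basis D i F) =
  lift (lab F) [ffun G => ((G == F) && (F \in D) && (#|F| == i))%:R].
Proof.
apply: (insubdK (0 : sub_of (tay D i))); apply: tay_lift => G; rewrite ffunE.
case: andP => [[/andP[/eqP -> FD] /eqP cF] _|]; last by rewrite eqxx.
by rewrite inE FD -lem_lab lepm_refl.
Qed.

Lemma tay_coord_sum D i (c : sub_of (tay D i)) :
  c = \sum_F tay_coord F c *: tay_basis D i F.
Proof.
apply: val_inj; rewrite raddf_sum /=.
apply/ffunP => G; rewrite sum_ffunE (bigD1 G) //= big1 => [|F FG]; last first.
  rewrite tay_basis_val !ffunE eq_sym (negbTE FG) /= scale0r.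
  exact: mulr0.
rewrite addr0 tay_basis_val !ffunE eqxx /= -(tay_coordK G c).
have [h|notDi] := boolP ((G \in D) && (#|G| == i)).
  by rewrite scale1r mulrC.
suff -> : tay_coord G c = 0 by rewrite mulr0 scale0r.
apply: (mulfI (mpolyX_neq0 (lab G))); rewrite tay_coordK mulr0.
apply/mpolyP => a; rewrite mcoeff0; apply/eqP; apply: contraNT notDi => nz.
have /tay_memP/(_ a G) := sub_valP c; rewrite ffunE => /(_ nz)[].
by rewrite inE => /andP[-> _] ->; rewrite eqxx.
Qed.

Lemma tay_projective D i : projective (sub_of (tay D i)).
Proof.
exact: dual_basis_projective (@tay_coord_linear D i) (@tay_coord_sum D i).
Qed.

End TaylorModules.

Lemma linear_sub (R : comNzRingType) (A B : lmodType R) (U : submodule A)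
    (V : submodule B) (f : {linear A -> B}) :
  (forall x, sm_mem U x -> sm_mem V (f x)) ->
  exists h : {linear sub_of U -> sub_of V},
    forall x, sub_val (h x) = f (sub_val x).
Proof.
move=> fUV.
have [|h hE] := @linear_pack R (sub_of U) (sub_of V)
    (fun x => SubOf (fUV _ (sub_valP x))).
  by move=> a x y; apply: val_inj; rewrite /= linearP.
by exists h => x; rewrite hE.
Qed.

(** * Resolutions supported on a simplicial complex *)

Section TaylorResolution.
Variables (K : fieldType) (n k : nat) (g : 'I_k -> 'X_{1..n}).
Variable I : monomial_ideal K n.
Hypothesis gI : forall a, 'X_[a] \in mi_ideal I <-> below g a != set0.
Local Notation S := {mpoly K[n]}.
Local Notation chains := {ffun {set 'I_k} -> S^o}.
Local Notation J := (ideal_module (mi_ideal I)).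
Local Notation bd := (@bd K n k).
Implicit Types (D : {set {set 'I_k}}) (F G : {set 'I_k}) (a b : 'X_{1..n}).

Lemma mem_idealP (f : S) :
  f \in mi_ideal I <-> forall a, f@_a != 0 -> below g a != set0.
Proof.
split=> [fI a|h]; first by rewrite -mcoeff_msupp => /(msupp_ideal fI)/gI.
by apply: ideal_msupp => m; rewrite mcoeff_msupp => /h/gI.
Qed.

Section Augmentation.
Variable D : {set {set 'I_k}}.
Hypothesis cD : is_complex D.
Hypothesis set0D : set0 \in D.
Hypothesis acD : forall a, below g a != set0 -> acyclic K (restriction D (below g a)).

Lemma bd_ideal c : tay_mem g D 1 c -> bd c set0 \in mi_ideal I.
Proof.
move=> hc; apply/mem_idealP => a nz; apply: contraNneq nz => a0.
have := strand_bd a c.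
rewrite (strand_below0 hc a0) boundary0 => /ffunP /(_ set0).
by rewrite [strand _ _ _]ffunE => ->; rewrite ffunE.
Qed.

(** In this encoding the coefficient of a vertex is already a multiple of its generator, so the
    augmentation is the plain sum of the coefficients, that is, the boundary at the empty face. *)
Lemma augmentation_exists : exists e : {linear sub_of (tay K g D 1) -> J},
  (forall c, ideal_val (e c) = bd (sub_val c) set0) /\
  (forall y, exists c, e c = y).
Proof.
have [|e eE] := @linear_pack S (sub_of (tay K g D 1)) J
    (fun c => IdealModule (bd_ideal (sub_valP c))).
  by move=> x c c'; apply: val_inj; rewrite /= linearP !ffunE.
exists e; split=> [c|y]; first by rewrite eE.
(* [y] placed on the empty face is a cycle; exactness there yields the preimage. *)
pose c : chains := [ffun F => if F == set0 then ideal_val y else 0].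
have yI a : (ideal_val y)@_a != 0 -> below g a != set0.
  exact: (iffLR (mem_idealP _) (ideal_valP y)).
have [a a0|||c' hc' bc'] := @tay_exact K n k g D 0 c acD.
- apply/ffunP => F; rewrite !ffunE; case: ifP => _; last exact: mcoeff0.
  by apply/eqP; apply: contraT => /yI; rewrite a0 eqxx.
- apply/tay_memP => a F; rewrite !ffunE; have [->|_] := eqVneq F set0; last first.
    by rewrite mcoeff0 eqxx.
  by move=> _; rewrite inE sub0set set0D cards0.
- apply/ffunP => G; rewrite bdE ffunE; apply: big1 => v _; rewrite ffunE.
  have /negbTE -> : v |: G != set0 by apply/set0Pn; exists v; rewrite setU11.
  by rewrite mulr0.
exists (SubOf (hc' : sm_mem (tay K g D 1) c')); apply: val_inj.
by rewrite eE /= bc' ffunE eqxx.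
Qed.

Lemma augmentation_kernel (e : {linear sub_of (tay K g D 1) -> J}) c :
  (forall c, ideal_val (e c) = bd (sub_val c) set0) ->
  e c = 0 <-> bd (sub_val c) = 0.
Proof.
move=> eE; split=> [/(congr1 (@ideal_val _ _))|bc]; last first.
  by apply: val_inj; rewrite /= eE bc ffunE.
rewrite eE => e0; apply/ffunP => G; rewrite [RHS]ffunE.
have [->|[v vG]] := set_0Vmem G; first exact: e0.
have /tay_memP hb := tay_bd cD (sub_valP c); apply/mpolyP => a; rewrite mcoeff0.
apply/eqP/negPn/negP => nz; have := hb a G; rewrite ffunE => /(_ nz)[_].
by move=> /eqP; rewrite cards_eq0 => /eqP G0; rewrite G0 inE in vG.
Qed.

Lemma tay_surj i c : tay_mem g D i.+1 c -> bd c = 0 ->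
  exists2 c', tay_mem g D i.+2 c' & bd c' = c.
Proof. by move=> hc; apply: tay_exact => // a; apply: strand_below0 hc. Qed.

(** The criterion of Bayer, Peeva and Sturmfels for a complex to support a resolution. Module [i] of
    the resolution of the ideal is spanned by the faces with [i.+1] vertices, hence the shift in the
    bound. *)
Lemma pdim_le_ideal d : (forall F, F \in D -> (#|F| <= d.+1)%N) -> pdim_le J d.
Proof.
move=> dimD; have [e [eE eS]] := augmentation_exists.
have dex i : exists h : {linear sub_of (tay K g D i.+2) -> sub_of (tay K g D i.+1)},
    forall x, sub_val (h x) = bd (sub_val x).
  by apply: linear_sub => x; apply: tay_bd.
pose del i := constructive_indefinite_description _ (dex i).
exists (fun i => sub_of (tay K g D i.+1)), (fun i => sval (del i)), e.
have delE i x : sub_val (sval (del i) x) = bd (sub_val x) := svalP (del i) x.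
split=> //.
- by move=> i; apply: tay_projective.
- move=> i di x; apply: val_inj; apply/ffunP => F; rewrite [RHS]ffunE.
  apply/mpolyP => a; rewrite mcoeff0; apply/eqP/negPn/negP => nz.
  have /tay_memP/(_ a F) := sub_valP x; rewrite ffunE => /(_ nz)[].
  by rewrite inE => /andP[/dimD leF _] cF; rewrite cF ltnS leqNgt di in leF.
- move=> x; rewrite augmentation_kernel //; split=> [|[y <-]].
    move=> /(tay_surj (sub_valP x))[c hc bc].
    exists (SubOf (hc : sm_mem (tay K g D 2) c)).
    by apply: val_inj; rewrite /= delE.
  by rewrite delE bd_bd.
- move=> i x; split=> [/(congr1 (@sub_val _ _ _))|[y <-]]; rewrite ?delE.
    move=> /(tay_surj (sub_valP x))[c hc bc].
    exists (SubOf (hc : sm_mem (tay K g D i.+3) c)).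
    by apply: val_inj; rewrite /= delE.
  by apply: val_inj; rewrite /= !delE bd_bd.
Qed.

End Augmentation.

Section Syzygies.
Let D : {set {set 'I_k}} := setT.

Lemma full_complex : is_complex D.
Proof. by move=> F G; rewrite !inE. Qed.

Lemma full_acyclic V : V != set0 -> acyclic K (restriction D V).
Proof.
move=> /set0Pn[v vV] j c hc c0; exists [ffun F => cone v c F]; last exact: boundary_cone.
move=> F; rewrite ffunE => /cone_supp[vF /hc[]]; rewrite !inE /= => FV cF.
rewrite (cardsD1 v F) vF cF; split=> //.
by rewrite -(setD1K vF) subUset sub1set vV.
Qed.

Lemma syz_closed i : submod_closed (fun c => tay_mem g D i c && (bd c == 0)).
Proof.
split=> [|x c c']; rewrite !unfold_in.
  by rewrite linear0 eqxx andbT; exact: (tay_closed K g D i).1.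
move=> /andP[hc /eqP bc] /andP[hc' /eqP bc'].
rewrite linearP bc bc' scaler0 addr0 eqxx andbT.
exact: (tay_closed K g D i).2.
Qed.

(** Here [i] counts the vertices of the sets: for positive [i] this is the syzygy module of order
    [i.+1] of S/I. *)
Definition syz i : submodule chains := Submodule (syz_closed i).

Lemma tay_to_syz i D' : exists e : {linear sub_of (tay K g D' i.+1) -> sub_of (syz i)},
  forall x, sub_val (e x) = bd (sub_val x).
Proof.
apply: linear_sub => x /tay_memP hx; rewrite /= bd_bd eqxx andbT.
apply: tay_bd full_complex _; apply/tay_memP => a.
by apply: is_chainW (hx a) => F; rewrite !inE => /andP[].
Qed.

Lemma syz_to_tay i : exists e : {linear sub_of (syz i) -> sub_of (tay K g D i)},
  forall x, sub_val (e x) = sub_val x.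
Proof. by apply: (@linear_sub _ _ _ _ _ idfun) => x /andP[]. Qed.

Lemma syz_pdim i d :
  retract_pdim_le (sub_of (syz i.+1)) d.+1 -> retract_pdim_le (sub_of (syz i.+2)) d.
Proof.
have [e eE] := tay_to_syz i.+1 D; have [f fE] := syz_to_tay i.+2.
apply: (retract_pdim_le_syzygy (i := f) (e := e)).
- by move=> x y /(congr1 (@sub_val _ _ _)); rewrite !fE => /val_inj.
- exact: tay_projective.
- move=> y; have /andP[hy /eqP by0] := sub_valP y.
  have [//|c hc bc] := tay_surj _ hy by0; first by move=> a; apply: full_acyclic.
  exists (SubOf (hc : sm_mem (tay K g D i.+2) c)).
  by apply: val_inj; rewrite /= eE.
- move=> x; split=> [/(congr1 (@sub_val _ _ _))|[y <-]].
    rewrite eE => bx.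
    have hx : sm_mem (syz i.+2) (sub_val x).
      by apply/andP; split; [exact: (sub_valP x) | apply/eqP].
    by exists (SubOf hx); apply: val_inj; rewrite /= fE.
  apply: val_inj; rewrite /= eE fE; apply/eqP.
  by have /andP[] := sub_valP y.
Qed.

Lemma syz1_pdim d : retract_pdim_le J d.+1 -> retract_pdim_le (sub_of (syz 1)) d.
Proof.
have [||e [eE eS]] := @augmentation_exists D; first by rewrite inE.
  by move=> a; apply: full_acyclic.
have [f fE] := syz_to_tay 1.
apply: (retract_pdim_le_syzygy (i := f) (e := e)) => //.
- by move=> x y /(congr1 (@sub_val _ _ _)); rewrite !fE => /val_inj.
- exact: tay_projective.
- move=> x; rewrite (augmentation_kernel full_complex) //; split=> [bx|[y <-]].
    have hx : sm_mem (syz 1) (sub_val x).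
      by apply/andP; split; [exact: (sub_valP x) | apply/eqP].
    by exists (SubOf hx); apply: val_inj; rewrite /= fE.
  by rewrite fE; apply/eqP; have /andP[] := sub_valP y.
Qed.

Lemma syz_projective q :
  pdim_le {ideal_quot (mi_ideal I)} q.+2 -> projective (sub_of (syz q.+1)).
Proof.
(* The final bound 0 is generalised to [d] for the induction on [q], since every further syzygy
   lowers the bound by one. *)
move=> /retract_pdim_le_ideal; move e0: 0%N => d hJ.
suff : retract_pdim_le (sub_of (syz q.+1)) d.
  by rewrite -e0; apply: retract_pdim_le0.
have : retract_pdim_le J (d + q.+1) by rewrite -e0.
elim: q d {e0 hJ} => [|q IH] d; first by rewrite addn1; apply: syz1_pdim.
by rewrite addnS -addSn => /IH/syz_pdim.
Qed.

End Syzygies.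

End TaylorResolution.

(** * The stoss complex of an ideal *)

Section MinimalGenerators.
Variables (K : fieldType) (n k : nat) (g : 'I_k -> 'X_{1..n}) (q : nat).
Local Notation S := {mpoly K[n]}.
Local Notation chains := {ffun {set 'I_k} -> S^o}.
Local Notation bd := (@bd K n k).
Implicit Types (D : {set {set 'I_k}}) (F G : {set 'I_k}) (a b : 'X_{1..n}).

Definition generates D : Prop := forall c, sm_mem (syz K g q) c ->
  exists2 c', tay_mem g D q.+1 c' & bd c' = c.

Lemma minimal_generating D : generates D ->
  exists2 D', generates D' & forall F, F \in D' -> ~ generates (D' :\ F).
Proof.
move: {2}#|D|.+1 (ltnSn #|D|) => N; elim: N D => // N IH D leD gD.
have [[F [FD gF]]|h] := classic (exists F, F \in D /\ generates (D :\ F)).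
  by apply: IH gF; move: leD; rewrite (cardsD1 F D) FD.
by exists D => // F FD gF; apply: h; exists F.
Qed.

(* Eliminating the generator F from a relation in degree [lab F] in which it
   occurs with a nonzero constant coefficient. *)
Lemma generates_eliminate D c F :
  generates D -> tay_mem g D q.+1 c -> bd c = 0 -> (c F)@_(lab g F) != 0 ->
  generates (D :\ F).
Proof.
move=> gD hc bc nz z /gD[c' hc' <-].
pose w := strand (lab g F) c.
have hw : is_chain (restriction D (below g (lab g F))) q.+1 w.
  by move/tay_memP: hc; apply.
have wF : w F != 0 by rewrite ffunE.
have bw : boundary w = 0.
  by rewrite -strand_bd bc; apply/ffunP => G; rewrite !ffunE mcoeff0.
clearbody w => {nz hc bc}.
(* The strand [w] with constant coefficients, normalised to 1 at [F]. Subtracting [c' F] times this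
   cycle removes [F] from [c']. The result stays in the Taylor module because every set occurring in
   [w] has a label dividing that of [F], which divides all monomials of [c' F]. *)
pose u : chains := [ffun G => (w G / w F)%:MP].
have bu : bd u = 0.
  apply: strandP => a; rewrite strand_bd; apply/ffunP => G.
  rewrite boundaryE [RHS]ffunE ffunE mcoeff0.
  transitivity (bdry (fun F' => ((w F)^-1 * (a == 0%MM)%:R) * w F' + 0) G).
    apply: eq_bdry => F'; rewrite !ffunE mcoeffC addr0 [RHS]mulrAC.
    by congr (_ * _); apply: mulrC.
  have bwG : bdry (w : {set 'I_k} -> K) G = 0 by rewrite -boundaryE bw ffunE.
  by rewrite bdry_linear bwG mulr0 add0r bdry0.
exists (- (c' F : S) *: u + c'); last by rewrite linearP bu scaler0 add0r.
apply/tay_memP => a G; rewrite !ffunE => nzG.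
have GF : G != F.
  apply: contraNneq nzG => ->.
  by rewrite divff // mpolyC1 [_ *: _]mulr1 addNr mcoeff0.
have [c'G|c'G] := eqVneq ((c' G : S)@_a) 0; last first.
  have /tay_memP/(_ a G) := hc'; rewrite ffunE => /(_ c'G)[].
  by rewrite !inE GF => ->.
move: nzG; rewrite mcoeffD c'G addr0 [_ *: _]mulrC mcoeffCM mcoeffN.
rewrite mulf_eq0 oppr_eq0 negb_or => /andP[wG c'F].
have {}wG : w G != 0 by apply: contraNneq wG => ->; rewrite mul0r.
have [] := hw _ wG; rewrite !inE GF => /andP[-> sG] ->; split=> //=.
apply: (subset_trans sG); apply: below_mono; rewrite lem_lab.
have /tay_memP/(_ a F) := hc'; rewrite ffunE => /(_ c'F)[].
by rewrite inE => /andP[].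
Qed.

Lemma minimal_generating_free D :
  projective (sub_of (syz K g q)) -> generates D ->
  (forall F, F \in D -> ~ generates (D :\ F)) ->
  forall c, tay_mem g D q.+1 c -> bd c = 0 -> c = 0.
Proof.
move=> pZ gD minD c hc bc.
have [e eE] := tay_to_syz K g q D.
have [y|s sE] := projective_lift (g := e) (f := idfun) pZ.
  have [c' hc' bc'] := gD _ (sub_valP y).
  exists (SubOf (hc' : sm_mem (tay K g D q.+1) c')).
  by apply: val_inj; rewrite /= eE.
have [|rho rhoE] := @linear_pack S _ _ (fun x => x - s (e x)).
  by move=> a x y; rewrite [e _]linearP [s _]linearP scalerBr opprD addrACA.
pose C : sub_of (tay K g D q.+1) := SubOf (hc : sm_mem (tay K g D q.+1) c).
suff : C = 0 by move=> /(congr1 (@sub_val _ _ _)).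
apply: (summand_in_max_eq0 (rho := rho) (N := fun x => e x = 0)
  (@tay_coord_linear _ _ _ g D q.+1) (@tay_coord_sum _ _ _ g D q.+1)).
- by move=> x; rewrite rhoE linearB sE subrr.
- by move=> x ex; rewrite rhoE ex linear0 subr0.
- move=> x F ex; apply/eqP/negPn/negP => nz.
  (* The basis element of [F] carries the monomial [lab g F], so the constant term of the coordinate
     is the coefficient at that degree. *)
  have xF : (sub_val x F : S)@_(lab g F) != 0.
    have := mcoeffMX (tay_coord F x) (lab g F) 0%MM.
    by rewrite addm0 mulrC tay_coordK => ->.
  have bx : bd (sub_val x) = 0 by rewrite -eE ex.
  apply: (minD F); last exact: generates_eliminate (sub_valP x) bx xF.
  have /tay_memP/(_ (lab g F) F) := sub_valP x; rewrite ffunE => /(_ xF)[].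
  by rewrite inE => /andP[].
- by apply: val_inj; rewrite /= eE.
Qed.

End MinimalGenerators.

Section StossResolution.
Variables (K : fieldType) (n k : nat) (g : 'I_k -> 'X_{1..n}) (q : nat).
Variable I : monomial_ideal K n.
Hypothesis gI : forall a, 'X_[a] \in mi_ideal I <-> below g a != set0.
Local Notation S := {mpoly K[n]}.

Implicit Types (F G : {set 'I_k}).

Lemma stoss_resolution : (0 < k)%N ->
  is_pdim {ideal_quot (mi_ideal I)} q.+2 ->
  exists2 D, stoss_complex K q.+1 D &
    forall a, below g a != set0 -> acyclic K (restriction D (below g a)).
Proof.
move=> k0 [hpd minpd].
have pZ := syz_projective gI hpd.
have [c /andP[hc /eqP bc]|D gD minD] := @minimal_generating K n k g q.+1 setT.
  by apply: (tay_exact _ _ hc bc) => a; [apply: full_acyclic | apply: strand_below0 hc].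
have freeD := minimal_generating_free pZ gD minD.
pose E : {set {set 'I_k}} :=
  [set F : {set 'I_k} | (#|F| <= q.+1)%N || (F \in D) && (#|F| == q.+2)].
have skelE F : (#|F| <= q.+1)%N -> F \in E by rewrite inE => ->.
have dimE F : F \in E -> (#|F| <= q.+2)%N.
  by rewrite inE => /orP[/leqW|/andP[_ /eqP ->]].
have cE : is_complex E.
  move=> F G FE GF; have [->//|neq] := eqVneq G F.
  apply: skelE; rewrite -ltnS; apply: leq_trans (dimE _ FE).
  by rewrite proper_card // properEneq neq.
have acE a : below g a != set0 -> acyclic K (restriction E (below g a)).
  (* Two points remain, both settled in degree [a] through [lift]: cycles on sets of size [q.+1] are
     filled because [D] generates the syzygies, and top cycles vanish because there are no
     relations. *)
  move=> a0; apply: acyclic_restriction skelE dimE a0 _ _ => c hc bc.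
    have hl : sm_mem (syz K g q.+1) (lift a c).
      apply/andP; split; last first.
        by rewrite bd_lift bc lift0.
      apply: tay_lift; apply: is_chainW hc => F.
      by rewrite !inE => /andP[_ ->].
    have [c' /tay_memP hc' bc'] := gD _ hl; exists (strand a c').
      move=> F nz; have [] := hc' a F nz.
      by rewrite !inE => /andP[-> ->] ->; rewrite eqxx orbT.
    by rewrite -strand_bd bc' strand_lift eqxx.
  suff l0 : lift a c = 0.
    have := strand_lift a a c; rewrite eqxx l0 => <-.
    by apply/ffunP => F; rewrite !ffunE mcoeff0.
  apply: freeD.
    apply: tay_lift => F nz; have [] := hc _ nz.
    rewrite !inE => /andP[FE ->] cF; rewrite cF ltnn /= in FE.
    by case/andP: FE => ->.
  by rewrite bd_lift bc lift0.
exists E => //; split=> //.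
- split=> //.
  (* A face of full size must exist, for otherwise [E] would support a resolution shorter than the
     projective dimension. *)
  have [[F [FE cF]]|noF] := classic (exists F, F \in E /\ #|F| = q.+2).
    by exists F.
  have : (q.+2 <= q.+1)%N; last by rewrite ltnn.
  apply: minpd; apply/pdim_le_quotient/(pdim_le_ideal gI cE _ acE).
    by apply: skelE; rewrite cards0.
  move=> F FE; have := dimE _ FE; rewrite leq_eqVlt => /orP[/eqP cF|//].
  by case: noF; exists F.
(* Every generator divides the lcm of all of them, so acyclicity of [E] itself is the case of this
   degree. *)
- have -> : E = restriction E (below g (lab g setT)).
    have -> : below g (lab g setT) = setT.
      by apply/eqP; rewrite eqEsubset subsetT -lem_lab lepm_refl.
    by rewrite restriction_setT.
  apply: acE; apply/set0Pn; exists (Ordinal k0).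
  have /subsetP : setT \subset below g (lab g setT) by rewrite -lem_lab lepm_refl.
  by apply; rewrite inE.
Qed.

End StossResolution.

(** * Stanley decompositions as box partitions *)

Section MonomialCoefficients.
Variables (K : fieldType) (n : nat).
Local Notation S := {mpoly K[n]}.
Implicit Types (Z : {set 'I_n}) (a : mdegree n) (b m u : 'X_{1..n}).

(* M has the classes of the monomials satisfying A as a K-basis. *)
Record monomial_coefs (M : mgmod K n) (A : 'X_{1..n} -> Prop)
    (coef : 'X_{1..n} -> M -> K) : Prop := MonomialCoefs {
  mc_linear : forall b c x y, coef b (c%:MP *: x + y) = c * coef b x + coef b y;
  mc_out : forall b x, coef b x != 0 -> A b;
  mc_eq0 : forall x, (forall b, coef b x = 0) -> x = 0;
  mc_homog : forall a x,
    mg_homog M a x <-> forall b, coef b x != 0 -> mdeg_of b = a;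
  mc_basis : forall b, A b -> exists x, forall b', coef b' x = (b' == b)%:R;
  mc_finite : forall x, exists s : seq 'X_{1..n}, forall b, coef b x != 0 -> b \in s;
  mc_mulX : forall b m x, A b ->
    coef b ('X_[m] *: x) = if (m <= b)%MM then coef (b - m)%MM x else 0 }.

(** The exponents of the monomials in ['X_[m]] times K[Z]. *)
Definition box (m : 'X_{1..n}) (Z : {set 'I_n}) (b : 'X_{1..n}) : bool :=
  (m <= b)%MM && [forall i, (b i != m i) ==> (i \in Z)].

Definition box_partition (A : 'X_{1..n} -> Prop) r (m : 'I_r -> 'X_{1..n})
    (Z : 'I_r -> {set 'I_n}) : Prop :=
  [/\ forall i b, box (m i) (Z i) b -> A b,
      forall b, A b -> exists i, box (m i) (Z i) b &
      forall i j b, box (m i) (Z i) b -> box (m j) (Z j) b -> i = j].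

Lemma box_sub m Z b i : box m Z b -> (b - m)%MM i != 0%N -> i \in Z.
Proof.
move=> /andP[_ /forallP /(_ i) /implyP h]; rewrite mnmBE => nz; apply: h.
by apply: contraNneq nz => ->; rewrite subnn.
Qed.

Lemma box_add m Z u : (forall i, u i != 0%N -> i \in Z) -> box m Z (m + u).
Proof.
move=> h; rewrite /box lem_addr; apply/forallP => i; apply/implyP.
rewrite mnmDE => nz; apply: h; apply: contraNneq nz => ->.
by rewrite addn0.
Qed.

Lemma in_KZX Z u : (forall i, u i != 0%N -> i \in Z) -> @in_KZ K n Z 'X_[u].
Proof. by move=> h m; rewrite msuppX inE => /eqP ->. Qed.

Section Coefs.
Variables (M : mgmod K n) (A : 'X_{1..n} -> Prop) (coef : 'X_{1..n} -> M -> K).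
Hypothesis mc : monomial_coefs A coef.

Lemma coef0 b : coef b 0 = 0.
Proof.
have := mc_linear mc b 1 0 0; rewrite scaler0 add0r mul1r -[LHS]addr0.
by move/addrI/esym.
Qed.

Lemma coefD b x y : coef b (x + y) = coef b x + coef b y.
Proof.
by have := mc_linear mc b 1 x y; rewrite mpolyC1 scale1r mul1r.
Qed.

Lemma coefZ b c x : coef b (c%:MP *: x) = c * coef b x.
Proof. by rewrite -[_ *: x]addr0 (mc_linear mc) coef0 addr0. Qed.

Lemma coefB b x y : coef b (x - y) = coef b x - coef b y.
Proof. by apply: (addIr (coef b y)); rewrite -coefD !subrK. Qed.

Lemma coef_sum b (T : Type) (s : seq T) (P : pred T) (F : T -> M) :
  coef b (\sum_(t <- s | P t) F t) = \sum_(t <- s | P t) coef b (F t).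
Proof.
apply: (big_ind2 (fun x y => coef b x = y)) => //; first exact: coef0.
by move=> x _ y _ <- <-; rewrite coefD.
Qed.

Lemma coef_inj x y : (forall b, coef b x = coef b y) -> x = y.
Proof.
move=> h; apply/eqP; rewrite -subr_eq0; apply/eqP/(mc_eq0 mc) => b.
by rewrite coefB h subrr.
Qed.

Lemma coef_mul b m c q x : A b -> (forall b', coef b' x = c * (b' == m)%:R) ->
  coef b (q *: x) = if (m <= b)%MM then q@_(b - m) * c else 0.
Proof.
move=> Ab hx; rewrite {1}[q]mpolyE scaler_suml coef_sum.
under eq_bigr => u _ do
  rewrite -mul_mpolyC -scalerA coefZ (mc_mulX mc) // hx fun_if mulr0.
case: ifP => mb; last first.
  apply: big1 => u _; case: ifP => // ub; case: eqP => [e|]; last by rewrite !mulr0.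
  by rewrite -e lem_subr in mb.
transitivity (\sum_(u <- msupp q) (if u == (b - m)%MM then q@_u * c else 0)).
  apply: eq_bigr => u _; case: (u =P (b - m)%MM) => [->|neq].
    have -> : (b - (b - m))%MM = m by rewrite submBA // addmC addmK.
    by rewrite lem_subr eqxx mulr1.
  case: ifP => // ub; case: eqP => [e|]; last by rewrite !mulr0.
  by case: neq; rewrite -e submBA // addmC addmK.
rewrite -big_mkcond; have [bs|bs] := boolP ((b - m)%MM \in msupp q).
  by rewrite -big_filter filter_pred1_uniq ?msupp_uniq // big_seq1.
rewrite big1_seq => [|u /andP[/eqP -> us]]; last by rewrite us in bs.
by rewrite (memN_msupp_eq0 bs) mul0r.
Qed.

End Coefs.
End MonomialCoefficients.

Section StanleyBoxes.
Variables (K : fieldType) (n : nat) (M : mgmod K n).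
Variables (A : 'X_{1..n} -> Prop) (coef : 'X_{1..n} -> M -> K).
Hypothesis mc : monomial_coefs A coef.
Local Notation S := {mpoly K[n]}.
Implicit Types (a : mdegree n) (b : 'X_{1..n}).

Lemma st_gen_neq0 (W : stanley_space M) q :
  in_KZ (st_vars W) q -> q != 0 -> q *: st_gen W != 0.
Proof. by move=> hq; apply: contraNneq => /(st_free hq) ->. Qed.

Lemma in_KZ1 Z : @in_KZ K n Z 1.
Proof. by rewrite -mpolyX0; apply: in_KZX => i; rewrite mnm0E. Qed.

(** The degree of a generator is a priori only an integer vector. Freeness makes the generator
    nonzero, so it has a monomial with nonzero coefficient, whose exponent is that degree. *)
Lemma st_gen_degree (W : stanley_space M) :
  exists m, mg_homog M (mdeg_of m) (st_gen W).
Proof.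
have [a ha] := st_homog W.
have gen0 : st_gen W != 0.
  by have := st_gen_neq0 (@in_KZ1 (st_vars W)) (oner_neq0 _); rewrite scale1r.
apply: NNPP => h; move/eqP: gen0; apply; apply: (mc_eq0 mc) => m.
apply/eqP/negPn/negP => nz; apply: h; exists m.
by rewrite (iffLR (mc_homog mc a _) ha _ nz).
Qed.

Section FromDecomposition.
Variables (r : nat) (W : 'I_r -> stanley_space M) (Phi : {ffun 'I_r -> M} -> M).
Local Notation V := (fun v : {ffun 'I_r -> M} => forall i, in_space (W i) (v i)).
Hypothesis PhiL : forall (c : K) u v, V u -> V v ->
  Phi (c%:MP *: u + v) = c%:MP *: Phi u + Phi v.
Hypothesis PhiH : forall a v, V v -> (forall i, mg_homog M a (v i)) ->
  mg_homog M a (Phi v).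
Hypothesis PhiI : forall u v, V u -> V v -> Phi u = Phi v -> u = v.
Hypothesis PhiS : forall x, exists2 v, V v & Phi v = x.
Variable m : 'I_r -> 'X_{1..n}.
Hypothesis homog_gen : forall i, mg_homog M (mdeg_of (m i)) (st_gen (W i)).

Let Z i := st_vars (W i).

Lemma in_space_linear i (d : K) x y : in_space (W i) x -> in_space (W i) y ->
  in_space (W i) (d%:MP *: x + y).
Proof.
move=> [q hq ->] [q' hq' ->]; exists (d%:MP * q + q').
  move=> b /msuppD_le; rewrite mem_cat mul_mpolyC => /orP[/msuppZ_le|] bs.
    exact: hq bs.
  exact: hq' bs.
by rewrite scalerDl scalerA.
Qed.

Lemma in_space0 i : in_space (W i) 0.
Proof. by exists 0; [move=> b; rewrite msupp0 | rewrite scale0r]. Qed.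

Lemma V_linear (d : K) u v : V u -> V v -> V (d%:MP *: u + v).
Proof. by move=> hu hv i; rewrite !ffunE; apply: in_space_linear. Qed.

Lemma V0 : V 0.
Proof. by move=> i; rewrite ffunE; apply: in_space0. Qed.

Lemma Phi0 : Phi 0 = 0.
Proof.
have := PhiL 1 V0 V0; rewrite mpolyC1 !scale1r addr0 -[LHS]addr0.
by move/addrI/esym.
Qed.

Lemma Phi_sum (T : eqType) (s : seq T) (d : T -> K) (F : T -> {ffun 'I_r -> M}) :
  (forall t, t \in s -> V (F t)) ->
  V (\sum_(t <- s) (d t)%:MP *: F t) /\
  Phi (\sum_(t <- s) (d t)%:MP *: F t) = \sum_(t <- s) (d t)%:MP *: Phi (F t).
Proof.
elim: s => [|t s IH] hF; first by rewrite !big_nil; split; [exact: V0 | exact: Phi0].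
have [|hV hP] := IH; first by move=> t' ts; apply: hF; rewrite inE ts orbT.
have Ft : V (F t) by apply: hF; rewrite mem_head.
by rewrite !big_cons; split; [apply: V_linear | rewrite PhiL ?hP].
Qed.

Definition single i (x : M) : {ffun 'I_r -> M} :=
  [ffun j => if j == i then x else 0].

Lemma V_single i x : in_space (W i) x -> V (single i x).
Proof.
by move=> hx j; rewrite ffunE; case: eqP => [->|_] //; apply: in_space0.
Qed.

Lemma in_spaceX i (u : 'X_{1..n}) : (forall l, u l != 0%N -> l \in Z i) ->
  in_space (W i) ('X_[u] *: st_gen (W i)).
Proof. by move=> hu; exists 'X_[u] => //; apply: in_KZX. Qed.

Lemma Phi_singleX i (u : 'X_{1..n}) b : (forall l, u l != 0%N -> l \in Z i) ->
  coef b (Phi (single i ('X_[u] *: st_gen (W i)))) != 0 -> b = (u + m i)%MM.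
Proof.
move=> hu nz.
have hV := V_single (in_spaceX hu).
have /(mc_homog mc)/(_ b nz) e : mg_homog M (mdeg_of u + mdeg_of (m i))
    (Phi (single i ('X_[u] *: st_gen (W i)))).
  apply: PhiH hV _ => j; rewrite ffunE; case: eqP => [_|_].
    exact: mg_homogX (homog_gen i).
  exact: mg_homog0.
by apply: mdeg_of_inj; rewrite mdeg_ofD.
Qed.

(** [Phi] is linear over [K] only, so elements of a Stanley space are split into monomial multiples
    of the generator before [Phi] is applied. *)
Lemma single_scale i (q : S) : single i (q *: st_gen (W i)) =
  \sum_(u <- msupp q) (q@_u)%:MP *: single i ('X_[u] *: st_gen (W i)).
Proof.
apply/ffunP => j; rewrite sum_ffunE ffunE; case: eqP => [->|neq].
  rewrite {1}[q]mpolyE scaler_suml; apply: eq_bigr => u _.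
  by rewrite !ffunE eqxx scalerA mul_mpolyC.
by rewrite big1 // => u _; rewrite !ffunE; case: eqP => // _; rewrite scaler0.
Qed.

Lemma decomposition_cover b : A b -> exists i, box (m i) (Z i) b.
Proof.
move=> Ab; have [x hx] := mc_basis mc Ab; have [v hv Pv] := PhiS x.
apply: NNPP => nobox.
have : coef b x = 0; last by rewrite hx eqxx => /eqP; rewrite oner_eq0.
have vE : v = \sum_(i <- enum 'I_r) (1 : K)%:MP *: single i (v i).
  apply/ffunP => j; rewrite sum_ffunE (bigD1_seq j) ?enum_uniq ?mem_enum //=.
  rewrite !ffunE eqxx mpolyC1 scale1r big1 ?addr0 // => i ij.
  by rewrite !ffunE eq_sym (negbTE ij) scaler0.
have [i _|_] := @Phi_sum _ (enum 'I_r) (fun=> 1) (fun i => single i (v i)).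
  exact/V_single/hv.
rewrite -vE Pv => ->; rewrite (coef_sum mc) big1 // => i _; rewrite (coefZ mc).
have [q hq ->] := hv i; rewrite single_scale.
have [u us|_ ->] := @Phi_sum _ (msupp q) (fun u => q@_u)
  (fun u => single i ('X_[u] *: st_gen (W i))).
  by apply: V_single; apply: in_spaceX => l; apply: hq us l.
rewrite (coef_sum mc) big1_seq ?mulr0 // => u /andP[_ us]; rewrite (coefZ mc).
suff -> : coef b (Phi (single i ('X_[u] *: st_gen (W i)))) = 0 by rewrite mulr0.
apply/eqP/negPn/negP => /(Phi_singleX (hq u us)) bE; apply: nobox; exists i.
by rewrite bE addmC; apply: box_add; apply: hq us.
Qed.

Lemma box_sub_add i b : box (m i) (Z i) b -> (b - m i + m i)%MM = b.
Proof. by case/andP => le_mb _; rewrite submK. Qed.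

Lemma box_gen_neq0 i b : box (m i) (Z i) b ->
  'X_[b - m i] *: st_gen (W i) != 0.
Proof.
move=> hb; apply: st_gen_neq0 (mpolyX_neq0 K _).
by apply: in_KZX => l; apply: box_sub hb.
Qed.

Lemma decomposition_box i b : box (m i) (Z i) b -> A b.
Proof.
move=> hb; apply: NNPP => nAb; move/eqP: (box_gen_neq0 hb); apply.
have := mg_homogX (b - m i)%MM (homog_gen i); set x := _ *: _ => hx.
apply: (mc_eq0 mc) => b'; apply/eqP/negPn/negP => nz; apply: nAb.
have := iffLR (mc_homog mc _ x) hx b' nz.
by rewrite -mdeg_ofD box_sub_add // => /mdeg_of_inj <-; exact: (mc_out mc nz).
Qed.

(** The elements of degree b in the two spaces are mapped into the same one-dimensional graded
    piece. With [al] and [be] the coefficients of their images, the evident linear relation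
    contradicts injectivity of [Phi]. *)
Lemma decomposition_disjoint i j b :
  box (m i) (Z i) b -> box (m j) (Z j) b -> i = j.
Proof.
move=> bi bj; apply/eqP/negPn/negP => ij.
pose y l := single l ('X_[b - m l] *: st_gen (W l)).
have Vy l : box (m l) (Z l) b -> V (y l).
  by move=> bl; apply: V_single; apply: in_spaceX => t; apply: box_sub bl.
have Hy l b' : box (m l) (Z l) b -> coef b' (Phi (y l)) != 0 -> b' = b.
  move=> bl nz; rewrite -(box_sub_add bl); apply: Phi_singleX nz => t.
    exact: box_sub bl.
pose al := coef b (Phi (y i)); pose be := coef b (Phi (y j)).
have comb : be%:MP *: y i + ((- al)%:MP *: y j + 0) = 0.
  apply: PhiI; [|exact: V0|].
    by apply: V_linear; [apply: Vy | apply: V_linear; [apply: Vy | apply: V0]].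
  rewrite !PhiL ?Phi0; try by [apply: Vy | apply: V0 |
    apply: V_linear; [apply: Vy | apply: V0]].
  apply: (mc_eq0 mc) => b'; rewrite addr0 (coefD mc) !(coefZ mc).
  have [->|neq] := eqVneq b' b; first by rewrite mulNr mulrC subrr.
  have z l : box (m l) (Z l) b -> coef b' (Phi (y l)) = 0.
    by move=> bl; apply: contraNeq neq => /(Hy _ _ bl)/eqP.
  by rewrite !z // !mulr0 addr0.
have kill (d : K) l : box (m l) (Z l) b ->
    d%:MP *: ('X_[b - m l] *: st_gen (W l)) = 0 -> d = 0.
  move=> bl; have hu := in_KZX (K := K) (fun i => @box_sub _ _ _ _ i bl).
  have hq : in_KZ (st_vars (W l)) (d%:MP * 'X_[b - m l]).
    by move=> u; rewrite mul_mpolyC => /msuppZ_le; apply: hu.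
  rewrite scalerA => /(st_free hq)/eqP.
  by rewrite mulf_eq0 (negbTE (mpolyX_neq0 K _)) orbF mpolyC_eq0 => /eqP.
have ji : (j == i) = false by rewrite eq_sym (negbTE ij).
have be0 : be = 0.
  apply: (kill _ i bi); have /ffunP/(_ i) := comb.
  by rewrite !ffunE eqxx eq_sym ji scaler0 !addr0.
have al0 : al = 0.
  apply/eqP; rewrite -oppr_eq0; apply/eqP/(kill _ j bj).
  have /ffunP/(_ j) := comb.
  by rewrite !ffunE eqxx ji scaler0 addr0 add0r.
have Py0 : Phi (y i) = 0.
  apply: (mc_eq0 mc) => b'; have [->|neq] := eqVneq b' b; first exact: al0.
  by apply: contraNeq neq => /(Hy _ _ bi)/eqP.
have y0 : y i = 0 by apply: PhiI; rewrite ?Py0 ?Phi0 //; [apply: Vy | apply: V0].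
by have /eqP := box_gen_neq0 bi; apply; have /ffunP/(_ i) := y0; rewrite !ffunE eqxx.
Qed.

End FromDecomposition.

Lemma boxes_of_decomposition r (W : 'I_r -> stanley_space M) :
  stanley_decomposition W ->
  exists m, box_partition A m (fun i => st_vars (W i)).
Proof.
move=> [Phi [PhiL PhiH PhiI PhiS]].
have [m hg] : {m | forall i, mg_homog M (mdeg_of (m i)) (st_gen (W i))}.
  have ch i := constructive_indefinite_description _ (st_gen_degree (W i)).
  by exists (fun i => sval (ch i)) => i; exact: (svalP (ch i)).
exists m; split.
- by move=> i b; exact: (decomposition_box hg).
- by move=> b; exact: (decomposition_cover PhiL PhiH PhiS hg).
- by move=> i j b; exact: (decomposition_disjoint PhiL PhiH PhiI hg).
Qed.

Section FromBoxes.
Variables (r : nat) (m : 'I_r -> 'X_{1..n}) (Z : 'I_r -> {set 'I_n}).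
Hypothesis part : box_partition A m Z.

Let boxA i b : box (m i) (Z i) b -> A b.
Proof. by case: part => h _ _ /h. Qed.

Let Am i : A (m i).
Proof.
apply: (@boxA i); rewrite -[X in box _ _ X]addm0; apply: box_add => l.
by rewrite mnm0E.
Qed.

Lemma box_space i : {W : stanley_space M | st_vars W = Z i /\
  forall b, coef b (st_gen W) = (b == m i)%:R}.
Proof.
apply: constructive_indefinite_description.
have [x hx] := mc_basis mc (Am i).
have homx : exists a, mg_homog M a x.
  exists (mdeg_of (m i)); apply/(mc_homog mc) => b; rewrite hx.
  by have [->|_] := eqVneq b (m i); rewrite ?eqxx.
(* The coefficient of [q *: x] at [m i + u] is that of [q] at [u], since this exponent lies in the
   box and hence in [A]. *)
have free q : in_KZ (Z i) q -> q *: x = 0 -> q = 0.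
  move=> hq qx; apply/mpolyP => u; rewrite mcoeff0; apply/eqP/negPn/negP => nz.
  have bx : box (m i) (Z i) (m i + u).
    by apply: box_add => l; apply: hq; rewrite mcoeff_msupp.
  have := @coef_mul _ _ _ _ _ mc (m i + u)%MM (m i) 1 q x (boxA bx).
  rewrite qx (coef0 mc) lem_addr addmC addmK mulr1 => h.
  by rewrite -h ?eqxx // in nz => b; rewrite hx mul1r.
by exists (StanleySpace homx free).
Qed.

Let W i := sval (box_space i).

Let WZ i : st_vars (W i) = Z i.
Proof. by case: (svalP (box_space i)). Qed.

Let coef_W i b : coef b (st_gen (W i)) = (b == m i)%:R.
Proof. by case: (svalP (box_space i)) => _; apply. Qed.

Let coef_mulW i b q : A b -> coef b (q *: st_gen (W i)) =
  if (m i <= b)%MM then q@_(b - m i) else 0.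
Proof.
move=> Ab; rewrite (coef_mul mc (m := m i) (c := 1) q Ab) ?mulr1 // => b'.
by rewrite coef_W mul1r.
Qed.

Let coef_space i b x : in_space (W i) x -> coef b x != 0 -> box (m i) (Z i) b.
Proof.
move=> [q hq ->] nz; have Ab := mc_out mc nz; move: nz; rewrite coef_mulW //.
case: ifP => [mb|_]; last by rewrite eqxx.
rewrite -mcoeff_msupp => us; rewrite -(submK mb) addmC; apply: box_add => l nz.
by rewrite -WZ; apply: hq us l nz.
Qed.

Lemma decomposition_of_boxes : exists W' : 'I_r -> stanley_space M,
  stanley_decomposition W' /\ forall i, st_vars (W' i) = Z i.
Proof.
have [_ cover disj] := part.
have coef_sumV (v : {ffun 'I_r -> M}) i b : (forall i, in_space (W i) (v i)) ->
    coef b (v i) = if box (m i) (Z i) b then coef b (\sum_j v j) else 0.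
  move=> hv; case: ifP => bi; last first.
    by apply/eqP; apply: contraFT bi => /(coef_space (hv i)).
  rewrite (coef_sum mc) (bigD1 i) //= big1 ?addr0 // => j ji.
  apply/eqP; apply: contraNT ji => /(coef_space (hv j)) bj.
  by apply/eqP; apply: disj bj bi.
exists W; split=> //; exists (fun v => \sum_i v i); split.
- move=> c u v _ _; rewrite scaler_sumr -big_split; apply: eq_bigr => i _.
  by rewrite !ffunE.
- move=> a v hv hom; apply/(mc_homog mc) => b; rewrite (coef_sum mc) => nz.
  have /existsP[i nzi] : [exists i, coef b (v i) != 0].
    apply: contraNT nz => /existsPn h; rewrite big1 // => i _.
    by have := h i; rewrite negbK => /eqP.
  exact: (iffLR (mc_homog mc _ _) (hom i)) nzi.
- move=> u v hu hv uv; apply/ffunP => i; apply: (coef_inj mc) => b.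
  by rewrite (coef_sumV u) // (coef_sumV v) // uv.
- move=> x; have [s hs] := mc_finite mc x.
  (* The terms of [x] in the i-th box, divided by the monomial of its corner. *)
  pose q i : S := \sum_(b <- undup s | box (m i) (Z i) b) coef b x *: 'X_[b - m i].
  have qE i b : (m i <= b)%MM ->
      (q i)@_(b - m i) = if box (m i) (Z i) b then coef b x else 0.
    move=> mb; rewrite raddf_sum /=.
    transitivity (\sum_(b' <- undup s | b' == b)
        if box (m i) (Z i) b' then coef b' x else 0).
      rewrite big_mkcond [RHS]big_mkcond; apply: eq_bigr => b' _.
      rewrite mcoeffZ mcoeffX; case: ifP => bx; last by rewrite if_same.
      have mb' : (m i <= b')%MM by case/andP: bx.
      have -> : ((b' - m i)%MM == (b - m i)%MM) = (b' == b).
        by rewrite -(eqm_add2r (m i)) !submK.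
      by case: eqP; rewrite ?mulr1 ?mulr0.
    have [bs|bs] := boolP (b \in s).
      rewrite -big_filter filter_pred1_uniq ?undup_uniq ?mem_undup // big_seq1 //.
    rewrite big1_seq => [|b' /andP[/eqP ->]]; last by rewrite mem_undup (negbTE bs).
    case: ifP => // _; apply/esym/eqP; apply: contraNT bs; exact: hs.
  exists [ffun i => q i *: st_gen (W i)].
    move=> i; rewrite ffunE; exists (q i) => // u; rewrite WZ.
    move=> /msupp_sum_le/flattenP[t /mapP[b]].
    rewrite mem_filter => /andP[bx _] -> /msuppZ_le; rewrite msuppX inE => /eqP -> l.
    exact: box_sub bx.
  apply: (coef_inj mc) => b; rewrite (coef_sum mc).
  have [Ab|nAb] := classic (A b); last first.
    have z y : coef b y = 0 by apply/eqP/negPn/negP => /(mc_out mc).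
    by rewrite z big1.
  have [i bi] := cover b Ab; rewrite (bigD1 i) //= ffunE coef_mulW //.
  have mb : (m i <= b)%MM by case/andP: bi.
  rewrite mb qE // bi big1 ?addr0 // => j ji; rewrite ffunE coef_mulW //.
  case: ifP => // mjb; rewrite qE //; case: ifP => // bj.
  by rewrite (disj _ _ _ bj bi) eqxx in ji.
Qed.

End FromBoxes.
End StanleyBoxes.

(** * Monomial bases of I and S/I *)

Section IdealCoefficients.
Variables (K : fieldType) (n : nat) (I : monomial_ideal K n).
Local Notation S := {mpoly K[n]}.
Local Notation pi := (\pi_{ideal_quot (mi_ideal I)}%qT).

Lemma ideal_mulX (m m' : 'X_{1..n}) :
  (m <= m')%MM -> 'X_[m] \in mi_ideal I -> 'X_[m'] \in mi_ideal I.
Proof. by move=> le_mm h; rewrite -(submK le_mm) mpolyXD; apply: idealMr. Qed.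

Lemma mcoeff_mulX (m b : 'X_{1..n}) (f : S) :
  ('X_[m] * f)@_b = if (m <= b)%MM then f@_(b - m) else 0.
Proof.
rewrite mulrC; case: ifP => [mb|nmb]; first by rewrite -{1}(submK mb) addmC mcoeffMX.
apply: memN_msupp_eq0; rewrite (perm_mem (msuppMX f m)).
by apply/negP => /mapP[u _ e]; rewrite e lem_addr in nmb.
Qed.

Lemma ideal_coefs : monomial_coefs (M := ideal_mgmod I)
  (fun b => 'X_[b] \in mi_ideal I)
  (fun b x => (ideal_val (x : ideal_module (mi_ideal I)))@_b).
Proof.
split.
- by move=> b c x y; rewrite /= mcoeffD mcoeffCM.
- by move=> b x; rewrite -mcoeff_msupp; apply: msupp_ideal; apply: ideal_valP.
- by move=> x h; apply: val_inj; apply/mpolyP => b; rewrite h mcoeff0.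
- move=> a x; split=> [h b|h b]; first by rewrite -mcoeff_msupp; apply: h.
  by rewrite mcoeff_msupp; apply: h.
- move=> b bI; exists (IdealModule bI) => b'.
  by rewrite /= mcoeffX eq_sym.
- move=> x; exists (msupp (ideal_val (x : ideal_module (mi_ideal I)))) => b.
  by rewrite mcoeff_msupp.
- by move=> b m x _; rewrite /= mcoeff_mulX.
Qed.

(** [repr x] is an arbitrary representative; its coefficients at monomials outside the ideal do not
    depend on the choice, and the others are discarded. *)
Definition quot_coef (b : 'X_{1..n}) (x : {ideal_quot (mi_ideal I)}) : K :=
  if 'X_[b] \in mi_ideal I then 0 else (repr x)@_b.

Lemma quot_coef_pi b (f : S) :
  quot_coef b (pi f) = if 'X_[b] \in mi_ideal I then 0 else f@_b.
Proof.
rewrite /quot_coef; case: ifPn => // bI.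
have : repr (pi f) - f \in mi_ideal I.
  apply/pi_eq0; rewrite rmorphB; apply/eqP; rewrite subr_eq0; apply/eqP.
  exact: reprK.
move=> h; apply/eqP; rewrite -subr_eq0 -mcoeffB; apply: contraNT bI => nz.
by apply: (msupp_ideal h); rewrite mcoeff_msupp.
Qed.

Lemma quotient_coefs : monomial_coefs (M := quotient_mgmod I)
  (fun b => 'X_[b] \notin mi_ideal I) quot_coef.
Proof.
have eq0 x : (forall b, quot_coef b x = 0) -> x = 0.
  move=> h; rewrite -[x]reprK; apply/pi_eq0/ideal_msupp => m.
  rewrite mcoeff_msupp => nz; apply: contraNT nz => mI.
  by have := h m; rewrite /quot_coef (negbTE mI) => ->.
split=> //.
- move=> b c x y; rewrite -[x]reprK -[y]reprK.
  have -> : c%:MP *: pi (repr x) + pi (repr y) = pi (c%:MP * repr x + repr y).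
    by rewrite rmorphD rmorphM.
  rewrite !quot_coef_pi; case: ifP => _; first by rewrite mulr0 addr0.
  by rewrite mcoeffD mcoeffCM.
- by move=> b x; rewrite /quot_coef; case: ifP => //; rewrite eqxx.
- move=> a x; split=> [[f hf <-] b|h].
    by rewrite quot_coef_pi; case: ifP; rewrite ?eqxx // -mcoeff_msupp => _ /hf.
  exists (poly_part a (repr x)); first exact: poly_part_homog.
  rewrite -[RHS]reprK; apply/eqP; rewrite -subr_eq0 -rmorphB; apply/eqP/pi_eq0.
  apply: ideal_msupp => m; rewrite mcoeff_msupp mcoeffB poly_partE => nz.
  apply: contraNT nz => mI; case: (mdeg_of m =P a) => [_|ma]; first by rewrite subrr.
  rewrite sub0r oppr_eq0; apply/negPn/negP => nz; apply: ma; apply: h.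
  by rewrite /quot_coef (negbTE mI).
- move=> b bI; exists (pi 'X_[b]) => b'; rewrite quot_coef_pi mcoeffX eq_sym.
  by case: ifP => //; case: eqP => // -> b'I; rewrite b'I in bI.
- move=> x; exists (msupp (repr x)) => b; rewrite mcoeff_msupp /quot_coef.
  by case: ifP => // _; rewrite eqxx.
- move=> b m x bI; rewrite -[x]reprK.
  have -> : 'X_[m] *: pi (repr x) = pi ('X_[m] * repr x) by rewrite rmorphM.
  rewrite !quot_coef_pi (negbTE bI) mcoeff_mulX; case: ifP => // mb.
  case: ifP => // h; case/negP: bI; apply: ideal_mulX h; exact: lem_subr.
Qed.

End IdealCoefficients.

(** * Cutting box partitions by a slice of constant large exponent *)

Section Slice.
Variables (n N : nat).

Definition extend (a : 'X_{1..n}) (B : nat) : 'X_{1..n + N} :=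
  [multinom match split i with inl j => a j | inr _ => B end | i < n + N].

Definition project (m : 'X_{1..n + N}) : 'X_{1..n} :=
  [multinom m (lshift N i) | i < n].

Lemma extend_lshift a B i : extend a B (lshift N i) = a i.
Proof. by rewrite mnmE (unsplitK (inl _ i)). Qed.

Lemma extend_rshift a B i : extend a B (rshift n i) = B.
Proof. by rewrite mnmE (unsplitK (inr _ i)). Qed.

(** Every new coordinate of the slice exceeds that of the corner, so a box can meet the slice only
    if all new variables are free in it. *)
Lemma box_extend (m : 'X_{1..n + N}) Z a B : (forall i, m (rshift n i) < B)%N ->
  box m Z (extend a B) =
    (setT \subset [set i | rshift n i \in Z]) &&
    box (project m) [set i | lshift N i \in Z] a.
Proof.
move=> ltB; apply/idP/idP.
  move=> /andP[/mnm_lepP le_ma /forallP h]; apply/andP; split.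
    apply/subsetP => i _; rewrite inE; apply: (implyP (h (rshift n i))).
    by rewrite extend_rshift neq_ltn ltB orbT.
  apply/andP; split.
    by apply/mnm_lepP => i; rewrite mnmE -(extend_lshift a B).
  apply/forallP => i; rewrite mnmE inE -(extend_lshift a B).
  exact: h.
move=> /andP[/subsetP hT /andP[/mnm_lepP le_ma /forallP h]]; apply/andP; split.
  apply/mnm_lepP => i; rewrite -(splitK i); case: (split i) => j /=.
    by rewrite extend_lshift; have := le_ma j; rewrite mnmE.
  by rewrite extend_rshift ltnW.
apply/forallP => i; rewrite -(splitK i); case: (split i) => j /=.
  by rewrite extend_lshift; have := h j; rewrite mnmE inE.
by have := hT j (in_setT j); rewrite inE => ->; rewrite implybT.
Qed.

Lemma slice_partition (A : 'X_{1..n} -> Prop) (A' : 'X_{1..n + N} -> Prop) B0 r'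
    (m' : 'I_r' -> 'X_{1..n + N}) Z' :
  (forall B a, (B0 <= B)%N -> A a <-> A' (extend a B)) ->
  box_partition A' m' Z' ->
  exists r (m : 'I_r -> 'X_{1..n}) Z, box_partition A m Z /\
    forall i, exists j, (#|Z' j| <= #|Z i| + N)%N.
Proof.
move=> hA [boxA' cover disj].
(* Beyond [B0] the slice of [A'] is [A]; the second summand puts it above every coordinate of every
   corner. *)
pose B := (B0 + (\sum_i mdeg (m' i)).+1)%N.
have AA' a : A a <-> A' (extend a B) by apply: hA; rewrite leq_addr.
have ltB i l : (m' i (rshift n l) < B)%N.
  rewrite /B addnS ltnS; apply: leq_trans (leq_addl _ _).
  rewrite (bigD1 i) //=; apply: leq_trans (leq_addr _ _).
  by rewrite mdegE (bigD1 (rshift n l)) //= leq_addr.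
pose I0 := [set i | setT \subset [set l | rshift n l \in Z' i]].
pose f (i : 'I_#|I0|) := enum_val i.
have fI i : setT \subset [set l | rshift n l \in Z' (f i)].
  by have := enum_valP i; rewrite inE.
exists #|I0|, (fun i => project (m' (f i))), (fun i => [set l | lshift N l \in Z' (f i)]).
split; first split.
- by move=> i a ba; apply/AA'/(boxA' (f i)); rewrite box_extend // fI.
- move=> a /AA'/cover[i]; rewrite box_extend // => /andP[iI ba].
  have iI0 : i \in I0 by rewrite inE.
  by exists (enum_rank_in iI0 i); rewrite /f enum_rankK_in.
- move=> i j a bi bj; apply: enum_val_inj; apply: (disj _ _ (extend a B)).
    by rewrite box_extend // fI.
  by rewrite box_extend // fI.
- move=> i; exists (f i).
  have /subset_leq_card : Z' (f i) \subset
      [set lshift N l | l in [set l | lshift N l \in Z' (f i)]] :|: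
      [set rshift n l | l in [set: 'I_N]].
    apply/subsetP => t; rewrite inE -(splitK t); case: (split t) => j /= tZ.
      by rewrite imset_f ?inE.
    by rewrite orbC imset_f ?inE.
  move/leq_trans; apply; apply: leq_trans (leq_card_setU _ _) _.
  rewrite card_imset ?leq_add2l; last exact: lshift_inj.
  by rewrite (leq_trans (leq_imset_card _ _)) // cardsT card_ord.
Qed.

End Slice.

Lemma bigmin_le n r (F : 'I_r -> nat) i : (\big[minn/n]_(j < r) F j <= F i)%N.
Proof.
have := mem_index_enum i; elim: (index_enum _) => // j s IH; rewrite inE big_cons.
by case/predU1P => [<-|/IH]; rewrite geq_min ?leqnn // orbC => ->.
Qed.

Lemma bigmin_ge n r (F : 'I_r -> nat) d :
  (d <= n)%N -> (forall i, d <= F i)%N -> (d <= \big[minn/n]_(j < r) F j)%N.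
Proof.
by move=> dn dF; apply: (big_ind (fun x => d <= x)%N) => // x y dx dy; rewrite leq_min dx.
Qed.

Lemma bounded_max (P : nat -> Prop) n d0 : P d0 -> (forall d, P d -> d <= n)%N ->
  exists d, [/\ P d, (d0 <= d)%N & forall d', P d' -> (d' <= d)%N].
Proof.
move=> Pd0 bnd; move: {2}(n - d0).+1 (ltnSn (n - d0)) => t.
elim: t d0 Pd0 => // t IH d0 Pd0 lt_t.
have [[d [Pd ltd]]|h] := classic (exists d, P d /\ (d0 < d)%N); last first.
  exists d0; split=> // d Pd; rewrite leqNgt; apply/negP => ltd.
  by apply: h; exists d.
have [|d' [Pd' le_d' max_d']] := IH d Pd.
  apply: leq_trans (lt_t : (n - d0 <= t)%N); apply: (ltn_sub2l _ ltd).
  exact: leq_trans ltd (bnd _ Pd).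
by exists d'; split=> //; apply: leq_trans (ltnW ltd) le_d'.
Qed.

(** [is_spdim M e] includes that a maximal depth exists. The slice supplies one decomposition, and
    depths are bounded by [n]. *)
Lemma spdim_slice (K : fieldType) n N (M : mgmod K n) (M' : mgmod K (n + N))
    A coef A' coef' B0 e' :
  monomial_coefs (M := M) A coef -> monomial_coefs (M := M') A' coef' ->
  (forall B a, (B0 <= B)%N -> A a <-> A' (extend N a B)) ->
  is_spdim M' e' -> exists2 e, is_spdim M e & (e <= e')%N.
Proof.
move=> mc mc' hA [d' [[r' [W' [dec' dW']]] _] ->].
have [m' part'] := boxes_of_decomposition mc' dec'.
have [r [m [Z [part cardZ]]]] := slice_partition hA part'.
have [W [dec WZ]] := decomposition_of_boxes mc part.
pose P d := exists r (W : 'I_r -> stanley_space M),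
  stanley_decomposition W /\ decomposition_depth W = d.
have [||d [Pd le_d max_d]] := @bounded_max P n (decomposition_depth W).
- by exists r, W.
- move=> d [s [U [_ <-]]]; rewrite /decomposition_depth.
  apply: (big_ind (fun x => x <= n)%N) => // [x y xn _|i _].
    by rewrite geq_min xn.
  by rewrite -[X in (_ <= X)%N]card_ord max_card.
have le_d' : (d' - N <= d)%N.
  (* The default value [n] of the minimum has to be compared as well, as the sliced family may be
     empty. *)
  apply: leq_trans le_d; apply: bigmin_ge => [|i].
    rewrite leq_subLR addnC -dW' /decomposition_depth.
    apply: (big_ind (fun x => x <= n + N)%N) => // [x y xn _|i _].
      by rewrite geq_min xn.
    by rewrite -[X in (_ <= X)%N]card_ord max_card.
  have [j hj] := cardZ i; rewrite leq_subLR addnC WZ; apply: leq_trans hj.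
  by rewrite -dW'; apply: bigmin_le.
exists (n - d)%N; last by lia.
exists d => //; split=> // s U dU; apply: max_d; by exists s, U.
Qed.

(** * The ideal of a stoss lattice *)

Section MonomialGenerators.
Variables (K : fieldType) (n : nat).
Implicit Types (m a b : 'X_{1..n}).

Lemma lem_anti m a : (m <= a)%MM -> (a <= m)%MM -> m = a.
Proof.
move=> /mnm_lepP ma /mnm_lepP am; apply/mnmP => i.
by apply/eqP; rewrite eqn_leq ma am.
Qed.

Lemma minimal_generator_below (I : monomial_ideal K n) a :
  'X_[a] \in mi_ideal I -> exists2 m, minimal_generator I m & (m <= a)%MM.
Proof.
move: {2}(mdeg a).+1 (ltnSn (mdeg a)) => t; elim: t a => // t IH a lt_t aI.
have [[m [mI ma neq]]|h] := classic (exists m, [/\ 'X_[m] \in mi_ideal I,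
    (m <= a)%MM & m <> a]).
  have [|//|m' hm' m'm] := IH m; last by exists m' => //; apply: lepm_trans m'm ma.
  apply: leq_trans (lt_t : (mdeg a <= t)%N); rewrite -(submK ma) mdegD.
  rewrite -[X in (X < _)%N]add0n ltn_add2r lt0n mdeg_eq0.
  by apply/eqP => am; apply: neq; rewrite -(submK ma) am add0m.
exists a; last exact: lepm_refl.
by split=> // m mI ma; apply: NNPP => neq; apply: h; exists m.
Qed.

Lemma mingens_family (I : monomial_ideal K n) k : has_mingens I k ->
  exists g : 'I_k -> 'X_{1..n}, forall a, 'X_[a] \in mi_ideal I <-> below g a != set0.
Proof.
move=> [s [us size_s hs]]; exists (fun i => nth 0%MM s i) => a; split.
  move=> /minimal_generator_below[m /hs ms ma]; apply/set0Pn.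
  have lt_k : (index m s < k)%N by rewrite -size_s index_mem.
  by exists (Ordinal lt_k); rewrite inE /= nth_index.
move=> /set0Pn[i]; rewrite inE => ga; apply: ideal_mulX ga _.
by have /hs[] : nth 0%MM s i \in s by rewrite mem_nth // size_s.
Qed.

Variables (k : nat) (g : 'I_k -> 'X_{1..n}).
Hypothesis k0 : (0 < k)%N.
Hypothesis g0 : forall i, g i != 0%MM.
Local Notation S := {mpoly K[n]}.

Let mem (f : S) : bool := all (fun a => below g a != set0) (msupp f).

Let memP (f : S) : reflect (forall a, f@_a != 0 -> below g a != set0) (mem f).
Proof.
by apply: (iffP allP) => h a; have := h a; rewrite mcoeff_msupp.
Qed.

Lemma generated_ideal_closed : idealr_closed mem.
Proof.
split.
- by apply/memP => a; rewrite mcoeff0 eqxx.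
- apply/negP => /memP /(_ 0%MM); rewrite mcoeff1 eqxx oner_eq0 => /(_ isT).
  case/set0Pn => i; rewrite inE => gi0; have := g0 i.
  rewrite (@lem_anti (g i) 0%MM) ?eqxx //.
  by apply/mnm_lepP => l; rewrite mnm0E.
- move=> x f f' /memP hf /memP hf'; apply/memP => a; rewrite -mcoeff_msupp.
  move=> /msuppD_le; rewrite mem_cat => /orP[|]; last first.
    by rewrite mcoeff_msupp; apply: hf'.
  move=> /msuppM_le/allpairsP[[b b'] /= [_]]; rewrite mcoeff_msupp => /hf nz ->.
  apply: contraNneq nz => e; rewrite -subset0 -e; apply: below_mono.
  exact: lem_addl.
Qed.

Lemma generated_ideal :
  exists J : monomial_ideal K n, forall a, 'X_[a] \in mi_ideal J <-> below g a != set0.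
Proof.
pose J : idealr S := HB.pack_for (idealr S) mem
  (isIdealr.Build S mem generated_ideal_closed).
have JX a : ('X_[a] \in J) = (below g a != set0).
  apply/idP/idP; first by move/memP/(_ a); rewrite mcoeffX eqxx oner_eq0; apply.
  move=> h; apply/memP => b; rewrite mcoeffX.
  by case: (a =P b) => [<-//|_]; rewrite eqxx.
have gJ i : 'X_[g i] \in J.
  by rewrite JX; apply/set0Pn; exists i; rewrite inE lepm_refl.
have neq0 : exists2 f, f \in J & f != 0.
  by exists 'X_[g (Ordinal k0)] => //; apply: mpolyX_neq0.
have gen : exists G : 'X_{1..n} -> Prop, forall f, f \in J <->
    exists s : seq (S * 'X_{1..n}),
      (forall t, t \in s -> G t.2) /\ f = \sum_(t <- s) t.1 * 'X_[t.2].
  exists (fun m => exists i, m = g i) => f; split; last first.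
    move=> [s [hs ->]]; rewrite big_seq; apply: rpred_sum => t /hs[i ->].
    exact: idealMr.
  (* [c a] is a generator dividing the monomial [a]; the default is not reached on the support of
     [f]. *)
  move=> /memP hf; pose c a := odflt (Ordinal k0) [pick i in below g a].
  exists [seq (f@_a *: 'X_[a - g (c a)], g (c a)) | a <- msupp f]; split.
    by move=> t /mapP[a _ ->]; exists (c a).
  rewrite big_map {1}[f]mpolyE; apply: eq_big_seq => a.
  rewrite mcoeff_msupp => /hf /set0Pn[i ia] /=.
  rewrite -scalerAl -mpolyXD submK // /c; case: pickP => [j|/(_ i)]; last by rewrite ia.
  by rewrite inE.
by exists (MonomialIdeal neq0 gen) => a; rewrite JX.
Qed.

End MonomialGenerators.

(** Acyclicity is a proposition, whereas membership in the lattice has to enter exponents as a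
    number. *)
Lemma set_of_prop (T : finType) (P : T -> Prop) :
  exists A : {set T}, forall x, x \in A <-> P x.
Proof.
exists [set x | if excluded_middle_informative (P x) then true else false] => x.
by rewrite inE; case: excluded_middle_informative.
Qed.

Section StossIdeal.
Variables (K : fieldType) (n k q : nat) (g : 'I_k -> 'X_{1..n}).
Variable D : {set {set 'I_k}}.
Hypothesis stossD : stoss_complex K q.+1 D.
Hypothesis gD : forall a, in_stoss_lattice K D (below g a).
Variable L : {set {set 'I_k}}.
Hypothesis LP : forall V, V \in L <-> in_stoss_lattice K D V.
Implicit Types (A V : {set 'I_k}).

Local Notation N := #|{set 'I_k}|.

(* The new variables Y_V, indexed by the elements V of the lattice, separate i
   from the elements of V: Y_V divides the i-th generator iff i is not in V. *)
Definition stoss_gen i : 'X_{1..n + N} :=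
  [multinom match split t with
            | inl l => g i l
            | inr v => nat_of_bool ((enum_val v \in L) && (i \notin enum_val v))
            end | t < n + N].
Local Notation h := stoss_gen.

Lemma stoss_gen_l i l : h i (lshift N l) = g i l.
Proof. by rewrite mnmE (unsplitK (inl _ l)). Qed.

Lemma stoss_gen_r i v :
  h i (rshift n v) = (enum_val v \in L) && (i \notin enum_val v).
Proof. by rewrite mnmE (unsplitK (inr _ v)). Qed.

Definition closure A : {set 'I_k} := \bigcap_(V in L | A \subset V) V.

Lemma closureP A i :
  reflect (forall V, V \in L -> A \subset V -> i \in V) (i \in closure A).
Proof.
apply: (iffP bigcapP) => [H V VL AV|H V /andP[VL AV]]; last exact: H.
by apply: H; rewrite VL.
Qed.

Lemma closure_lattice A : closure A \in L.
Proof.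
by apply/LP; apply: (stoss_lattice_bigcap stossD) => V /andP[/LP].
Qed.

Lemma closure_id V : V \in L -> closure V = V.
Proof.
move=> VL; apply/eqP; rewrite eqEsubset; apply/andP; split; apply/subsetP => i.
  by move/closureP; apply.
by move=> iV; apply/closureP => W _ /subsetP; apply.
Qed.

Lemma sub_below_lab (n' : nat) (f : 'I_k -> 'X_{1..n'}) A : A \subset below f (lab f A).
Proof. by rewrite -lem_lab lepm_refl. Qed.

(** If i is outside the closure, some lattice element V contains A but not i, and Y_V divides the
    generator [h i] but not the lcm of A. Conversely, the old variables cause no obstruction because
    [below g (lab g A)] is itself a lattice element containing A; and if Y_V divides [h i] for an i
    in the closure, then A is not contained in V, so Y_V divides a generator in A. *)
Lemma below_lab A : below h (lab h A) = closure A.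
Proof.
apply/setP => i; apply/idP/closureP => [|H].
  rewrite inE => /mnm_lepP hi V VL AV; apply/negPn/negP => iV.
  pose v := rshift n (enum_rank V).
  (* The lcm of A with the exponent of Y_V set to 0 is still a common multiple of A, so Y_V does not
     divide the lcm. *)
  pose m := [multinom if t == v then 0%N else lab h A t | t < n + N].
  have mE t : m t = if t == v then 0%N else lab h A t by exact: mnmE.
  have /mnm_lepP/(_ v) : (lab h A <= m)%MM.
    rewrite lem_lab; apply/subsetP => j jA; rewrite inE; apply/mnm_lepP => t.
    rewrite mE; have [->|_] := eqVneq t v.
      by rewrite /v stoss_gen_r enum_rankK (subsetP AV) // andbF.
    have := subsetP (sub_below_lab h A) _ jA; rewrite inE => /mnm_lepP; apply.
  rewrite mE eqxx => le0; have := leq_trans (hi v) le0.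
  by rewrite /v stoss_gen_r enum_rankK VL iV.
rewrite inE; apply/mnm_lepP => t; rewrite -(splitK t); case: (split t) => l /=.
  rewrite stoss_gen_l.
  have : i \in below g (lab g A) by apply: H; [apply/LP | apply: sub_below_lab].
  rewrite inE => /mnm_lepP/(_ l)/leq_trans; apply.
  have /mnm_lepP/(_ l) : (lab g A <= project (lab h A))%MM.
    rewrite lem_lab; apply/subsetP => j jA; rewrite inE; apply/mnm_lepP => l'.
    have := subsetP (sub_below_lab h A) _ jA; rewrite inE => /mnm_lepP/(_ (lshift N l')).
    by rewrite stoss_gen_l mnmE.
  by rewrite mnmE.
rewrite stoss_gen_r; case: andP => // -[VL iV].
have /subsetPn[j jA jV] : ~~ (A \subset enum_val l).
  by apply: contraNN iV; apply: H.
have := subsetP (sub_below_lab h A) _ jA; rewrite inE => /mnm_lepP/(_ (rshift n l)).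
by rewrite stoss_gen_r VL jV.
Qed.

Lemma below_lattice a : below h a \in L.
Proof.
suff -> : below h a = closure (below h a) by apply: closure_lattice.
rewrite -below_lab; apply/eqP; rewrite eqEsubset sub_below_lab /=.
by apply: below_mono; rewrite lem_lab.
Qed.

Lemma stoss_gen_anti i j : (h i <= h j)%MM -> i = j.
Proof.
move=> hij; have : i \in closure [set j].
  rewrite -below_lab inE; apply: lepm_trans hij _.
  by have := subsetP (sub_below_lab h [set j]) j; rewrite !inE eqxx; apply.
rewrite closure_id; last by apply/LP; apply: (stoss_lattice_set1 stossD).
by rewrite inE => /eqP.
Qed.

Lemma stoss_gen_neq0 i : h i != 0%MM.
Proof.
apply/eqP => hi0; have : i \in closure set0.
  rewrite -below_lab inE hi0; apply/mnm_lepP => l; by rewrite mnm0E.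
by rewrite closure_id ?inE //; apply/LP; left.
Qed.

(** The new variables occur in the generators with exponent at most 1, so any positive exponent of
    them is harmless; hence the threshold 1 in the final slices. *)
Lemma below_stoss_gen a B : (0 < B)%N -> below h (extend N a B) = below g a.
Proof.
move=> B0; apply/setP => i; rewrite !inE; apply/mnm_lepP/mnm_lepP => H l.
  by have := H (lshift N l); rewrite stoss_gen_l extend_lshift.
rewrite -(splitK l); case: (split l) => t /=.
  by rewrite stoss_gen_l extend_lshift.
by rewrite stoss_gen_r extend_rshift; case: andP.
Qed.

Variable J : monomial_ideal K (n + N).
Hypothesis hJ : forall a, 'X_[a] \in mi_ideal J <-> below h a != set0.

Lemma stoss_mingens m : minimal_generator J m <-> exists i, m = h i.
Proof.
have genJ i : 'X_[h i] \in mi_ideal J.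
  by apply/hJ/set0Pn; exists i; rewrite inE lepm_refl.
split=> [[/hJ/set0Pn[i]]|[i ->]].
  by rewrite inE => him minm; exists i; apply/esym/minm.
split=> // m' /hJ/set0Pn[j]; rewrite inE => hj m'i.
have ji := stoss_gen_anti (lepm_trans hj m'i); rewrite ji in hj.
exact: lem_anti.
Qed.

Lemma stoss_lcm m : in_lcm_lattice J m <-> exists A, m = lab h A.
Proof.
split=> [[s hs ->]|[A ->]]; last first.
  exists [seq h i | i <- enum A] => // m' /mapP[i _ ->].
  by apply/stoss_mingens; exists i.
exists [set i | h i \in s]; set m1 := foldr _ _ _; set m2 := lab _ _.
have eqle x : (m1 <= x)%MM = (m2 <= x)%MM.
  rewrite lem_lab lem_foldr_mlcm; apply/allP/subsetP => H i.
    by rewrite !inE; apply: H.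
  move=> is_; have /stoss_mingens[j ij] := hs _ is_; rewrite ij.
  by have := H j; rewrite !inE -ij; apply.
by apply: lem_anti; [rewrite eqle | rewrite -eqle]; apply: lepm_refl.
Qed.

Lemma stoss_lattice_iso : lcm_lattice_iso J D.
Proof.
exists (below h); split.
- by move=> m _; apply/LP/below_lattice.
- move=> V /LP VL; exists (lab h V); first by apply/stoss_lcm; exists V.
  by rewrite below_lab closure_id.
- move=> m m' /stoss_lcm[A ->] _; split=> [/below_mono|]; first by apply.
  by move=> sub; rewrite lem_lab; apply: subset_trans (sub_below_lab h A) sub.
Qed.

Lemma stoss_acyclic a : below h a != set0 -> acyclic K (restriction D (below h a)).
Proof. by move=> nz; have /LP[e|//] := below_lattice a; rewrite e eqxx in nz. Qed.

End StossIdeal.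

Lemma stoss_model (K : fieldType) (n k q : nat) (I : monomial_ideal K n) :
  (0 < k)%N -> has_mingens I k -> is_pdim {ideal_quot (mi_ideal I)} q.+2 ->
  exists N (J : monomial_ideal K (n + N)),
    [/\ exists2 D : {set {set 'I_k}}, stoss_complex K q.+1 D & lcm_lattice_iso J D,
        pdim_le (ideal_module (mi_ideal I)) q.+1,
        pdim_le (ideal_module (mi_ideal J)) q.+1 &
        forall B a, (0 < B)%N ->
          ('X_[a] \in mi_ideal I) = ('X_[extend N a B] \in mi_ideal J)].
Proof.
move=> k0 /mingens_family[g gI] pdI.
have [D stossD acD] := stoss_resolution gI k0 pdI.
have gD a : in_stoss_lattice K D (below g a).
  by have [->|/acD] := eqVneq (below g a) set0; [left | right].
have [L LP] := set_of_prop (in_stoss_lattice K D).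
have [J hJ] := generated_ideal K k0 (stoss_gen_neq0 gD LP).
have [cD [_ dimD] skelD _] := stossD.
have D0 : set0 \in D by apply: skelD; rewrite cards0.
exists #|{set 'I_k}|, J; split.
- by exists D => //; exact: (stoss_lattice_iso stossD gD LP hJ).
- exact: (pdim_le_ideal gI cD D0 acD).
- exact: (pdim_le_ideal hJ cD D0 (stoss_acyclic stossD gD LP)).
- move=> B a B0; apply/idP/idP => [/gI nz|/hJ nz].
    by apply/hJ; rewrite below_stoss_gen.
  by apply/gI; rewrite below_stoss_gen in nz.
Qed.

Theorem theorem1p2 (K : fieldType) (k p : nat) (hk : (2 <= k)%N) (hp : (2 <= p)%N) :
  ((forall (n : nat) (I : monomial_ideal K n),
      (exists2 D : {set {set 'I_k}},
         stoss_complex K p.-1 D & lcm_lattice_iso I D) ->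
      stanley_conjecture (quotient_mgmod I)) ->
   forall (n : nat) (I : monomial_ideal K n),
     has_mingens I k -> is_pdim (quotient_mgmod I) p ->
     stanley_conjecture (quotient_mgmod I)) /\
  ((forall (n : nat) (I : monomial_ideal K n),
      (exists2 D : {set {set 'I_k}},
         stoss_complex K p.-1 D & lcm_lattice_iso I D) ->
      stanley_conjecture (ideal_mgmod I)) ->
   forall (n : nat) (I : monomial_ideal K n),
     has_mingens I k -> is_pdim (quotient_mgmod I) p ->
     stanley_conjecture (ideal_mgmod I)).
Proof.
(* With p = q + 2 the stoss complex has dimension q + 1, which is positive, as needed for singletons
   to lie in its lattice. *)
case: p hp => [//|[//|q]] _; have k0 : (0 < k)%N by apply: ltnW.
split=> conj n I gensI pdI.
  have [N [J [isoJ _ pdJ IJ]]] := stoss_model k0 gensI pdI.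
  have [e' [p' [spJ [_ min_p'] le_ep]]] := conj _ _ isoJ.
  have [|e spI le_ee'] := spdim_slice (quotient_coefs I) (quotient_coefs J) _ spJ
    (B0 := 1).
    by move=> B a B0; rewrite (IJ B a B0).
  exists e, q.+2; split=> //; apply: leq_trans le_ee' (leq_trans le_ep _).
  exact/min_p'/pdim_le_quotient.
have [N [J [isoJ pdI1 pdJ IJ]]] := stoss_model k0 gensI pdI.
have [e' [p' [spJ [_ min_p'] le_ep]]] := conj _ _ isoJ.
have [|e spI le_ee'] := spdim_slice (ideal_coefs I) (ideal_coefs J) _ spJ (B0 := 1).
  by move=> B a B0; rewrite (IJ B a B0).
(* The module I has projective dimension p - 1: the stoss resolution bounds it above, and a shorter
   resolution of I would give one of S/I shorter than p. *)
exists e, q.+1; split=> //.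
  split=> // d /pdim_le_quotient pdq.
  by have [_ minI] := pdI; have := minI _ pdq.
exact: leq_trans le_ee' (leq_trans le_ep (min_p' _ pdJ)).
Qed.
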